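(* Let $f:\mathbb{R}^d\to\mathbb{R}$ be convex and Lipschitz continuous with constant $L_0>0$, and let $x^\ast$ be a global minimizer of $f$. Run the zeroth-order iteration $x_{t+1}=x_t-\eta\,\tilde g(x_t)$ with one-point residual feedback (defined in the context) for $T\ge 1$ iterations and let $\bar x=\frac1T\sum_{t=0}^{T-1}x_t$. (i) If $\eta=\frac{1}{2dL_0\sqrt T}$ and $\delta=\frac{1}{\sqrt T}$, then $$\mathbb{E}[f(\bar x)]-f(x^\ast)=\mathcal{O}\big(d\,T^{-0.5}\big).$$ (ii) If additionally $f$ is differentiable with Lipschitz continuous gradient with constant $L_1>0$, and $\eta=\frac{1}{2\tilde L(d+4)^2T^{1/3}}$, $\delta=\frac{\sqrt d}{T^{1/3}}$ with $\tilde L=\max\{L_0,16L_1\}$, then $$\mathbb{E}[f(\bar x)]-f(x^\ast)=\mathcal{O}\big(d^2\,T^{-2/3}\big).$$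
   Context: Deterministic residual feedback: $x_0\in\mathbb{R}^d$ is a given deterministic point, $u_0,u_1,u_2,\dots$ are i.i.d. standard Gaussian vectors in $\mathbb{R}^d$, $\delta>0$ is the exploration parameter and $\eta>0$ the stepsize. For $t\ge 1$, $$\tilde g(x_t)=\frac{u_t}{\delta}\big(f(x_t+\delta u_t)-f(x_{t-1}+\delta u_{t-1})\big),$$ and at $t=0$, $\tilde g(x_0)=\frac{u_0}{\delta}f(x_0+\delta u_0)$. The iterates are $x_{t+1}=x_t-\eta\,\tilde g(x_t)$. Meaning of $\mathcal{O}$: the left side is at most $C$ times the displayed rate, where $C$ depends only on $L_0$, $\|x_0-x^\ast\|$, $\mathbb{E}[\|\tilde g(x_0)\|^2]$ and, in (ii), also $L_1$ (no further dependence on $d,T$). *)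

(* Defs.v *)
From HB Require Import structures.
From mathcomp Require Export all_boot all_order all_algebra.
From mathcomp Require Export all_classical all_reals all_analysis.

Set Implicit Arguments.
Unset Strict Implicit.
Unset Printing Implicit Defensive.

Export Order.TTheory GRing.Theory Num.Theory.
Export numFieldNormedType.Exports.

Local Open Scope classical_set_scope.
Local Open Scope ring_scope.

(* Points of R^d are row vectors.  The norm `|x| that the library puts on
   'rV[R]_d is the sup norm, hence a separate Euclidean norm; both induce the
   same topology, so [differentiable] and Borel sets are unaffected. *)
Definition enorm (R : realType) (d : nat) (x : 'rV[R]_d) : R :=
  Num.sqrt (\sum_(i < d) x ord0 i ^+ 2).

Definition lipschitz_const (R : realType) (d : nat) (L : R)
    (f : 'rV[R]_d -> R) : Prop :=
  forall x y, `|f x - f y| <= L * enorm (x - y).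

Definition gradient (R : realType) (d : nat) (f : 'rV[R]_d -> R)
    (x : 'rV[R]_d) : 'rV[R]_d :=
  \row_(i < d) 'D_(delta_mx ord0 i) f x.

Definition lipschitz_gradient_const (R : realType) (d : nat) (L : R)
    (f : 'rV[R]_d -> R) : Prop :=
  (forall x, differentiable f x) /\
  (forall x y, enorm (gradient f x - gradient f y) <= L * enorm (x - y)).

Definition convex_fun (R : realType) (d : nat) (f : 'rV[R]_d -> R) : Prop :=
  convex_function [set: convex_lmodType 'rV[R]_d] f.

Definition global_minimizer (R : realType) (d : nat) (f : 'rV[R]_d -> R)
    (xstar : 'rV[R]_d) : Prop :=
  forall y, f xstar <= f y.

Definition borel_set (T : topologicalType) : set (set T) := <<s @open T >>.

Definition random_vector (R : realType) (disp : measure_display)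
    (Omega : measurableType disp) (d : nat) (X : Omega -> 'rV[R]_d) : Prop :=
  forall B, borel_set B -> measurable (X @^-1` B).

(* Mutual independence of a possibly infinite family, with values in E equipped
   with the sigma-algebra S: the product rule over every finite subfamily. *)
Definition mutually_independent (R : realType) (disp : measure_display)
    (Omega : measurableType disp) (P : probability Omega R) (I : eqType)
    (E : Type) (S : set (set E)) (X : I -> Omega -> E) : Prop :=
  forall (J : seq I) (B : I -> set E), uniq J ->
    (forall i, i \in J -> S (B i)) ->
    P (\bigcap_(i in [set` J]) (X i @^-1` B i)) =
    (\prod_(i <- J) P (X i @^-1` B i))%E.

Definition standard_gaussian (R : realType) (disp : measure_display)
    (Omega : measurableType disp) (P : probability Omega R) (d : nat)
    (X : Omega -> 'rV[R]_d) : Prop :=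
  [/\ random_vector X,
      forall (i : 'I_d) (A : set R), measurable A ->
        P ((fun w => X w ord0 i) @^-1` A) = normal_prob 0 1 A &
      mutually_independent P [set A : set R | measurable A]
        (fun (i : 'I_d) w => X w ord0 i)].

Definition iid_standard_gaussian (R : realType) (disp : measure_display)
    (Omega : measurableType disp) (P : probability Omega R) (d : nat)
    (u : nat -> Omega -> 'rV[R]_d) : Prop :=
  (forall t, standard_gaussian P (u t)) /\
  mutually_independent P (@borel_set 'rV[R]_d) u.

(* [x] and [g] are the iterates and the residual-feedback gradient estimates
   driven by the noise [u], from the deterministic starting point [x0]. *)
Record residual_feedback_run (R : realType) (Omega : Type) (d : nat)
    (f : 'rV[R]_d -> R) (eta delta : R) (x0 : 'rV[R]_d)
    (u x g : nat -> Omega -> 'rV[R]_d) : Prop := ResidualFeedbackRun {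
  rf_x0 : forall w, x 0%N w = x0 ;
  rf_g0 : forall w,
    g 0%N w = (f (x 0%N w + delta *: u 0%N w) / delta) *: u 0%N w ;
  rf_gS : forall t w,
    g t.+1 w = ((f (x t.+1 w + delta *: u t.+1 w) - f (x t w + delta *: u t w))
                / delta) *: u t.+1 w ;
  rf_xS : forall t w, x t.+1 w = x t w - eta *: g t w }.

Definition average_iterate (R : realType) (Omega : Type) (d : nat)
    (x : nat -> Omega -> 'rV[R]_d) (T : nat) (w : Omega) : 'rV[R]_d :=
  T%:R^-1 *: \sum_(t < T) x t w.

Definition second_moment (R : realType) (disp : measure_display)
    (Omega : measurableType disp) (P : probability Omega R) (d : nat)
    (X : Omega -> 'rV[R]_d) : R :=
  fine ('E_P[fun w => (enorm (X w) ^+ 2)%R])%E.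

(* Main.v *)
(* Convexity is used only along the segment from the query y_t = x_t + delta u_t
   towards xs + delta u_t, with xs the minimizer:
     s (f(y_t) - f(xs + delta u_t)) <= f(y_t) - f(y_t - s (x_t - xs)).
   Moving y_t by s (x_t - xs) one coordinate at a time amounts, each time, to
   shifting a single Gaussian coordinate by a quantity independent of it.  For an
   L-Lipschitz k and Z ~ N(0,1),
     |E k(Z) - E k(Z - a) - a E[Z k(Z)]| <= C L a^2,
   so the right-hand side has expectation at most s E<x_t - xs, g_t> + O(s^2).
   Dividing by s and letting s tend to 0,
     E f(y_t) - E f(xs + delta u_t) <= E<x_t - xs, g_t>,
   without differentiating f or its Gaussian smoothing.  Replacing y_t by x_t and
   xs + delta u_t by xs costs O(delta d), or O(delta^2 d) when f is smooth.  The
   second moments satisfy E|g_{t+1}|^2 <= E|g_t|^2 / 2 + 16 L0^2 d^2; when f is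
   smooth, |grad f|^2 <= 2 L1 (f - min f) gives instead a recursion whose
   source terms are multiples of the optimality gaps, which the small stepsize
   lets the telescoped distance recursion absorb. *)
From HB Require Import structures.
Require Import Defs.
From mathcomp Require Import ring lra measurable_realfun.
Set Implicit Arguments.
Unset Strict Implicit.
Unset Printing Implicit Defensive.
Local Open Scope classical_set_scope.
Local Open Scope ring_scope.

(** * Gaussian integrals and Stein's estimate *)

(** The baseline f(y_{t-1}) in the estimate is harmless because, with all other noise fixed, it is a
    constant: added to k it changes neither the finite difference nor, as E Z = 0, the term a
    E[Z k(Z)]. So Stein's estimate has to be controlled by the Lipschitz constant alone, whatever
    the size of k(0), and for every real shift, since the shift s (x_t - xs)_i / delta is random and
    unbounded. Conditioning is replaced by a product measure: the sample space with the
    sigma-algebra generated by all scalar noise coordinates but one, times N(0,1). As x_t depends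
    only on u_0, ..., u_{t-1}, both the shift and the baseline are measurable for that sigma-algebra
    whenever the omitted coordinate belongs to u_t. Treating one coordinate at a time requires only
    the one-dimensional Gaussian density. Its price, d error terms of order s^2 that grow as delta
    shrinks, vanishes with s and never enters the rate. *)

Section lebesgue_shift.
Context {R : realType}.
Local Notation mu := (@lebesgue_measure R).
Local Open Scope ereal_scope.

Lemma lebesgue_measure_shift (a : R) (A : set R) : measurable A ->
  pushforward mu ((fun x => (x - a)%R) : _ -> measurableTypeR R) A = mu A.
Proof.
have mphi : measurable_fun setT ((fun x => (x - a)%R) : _ -> measurableTypeR R).
  exact: measurable_funB.
move=> mA; apply/esym/lebesgue_measure_unique => // _ [[c b]] _ <- /=.
rewrite /pushforward.
have -> : (fun x : R => (x - a)%R) @^-1` [set` `]c, b]] = [set` `]c + a, b + a]%R].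
  by rewrite predeqE => x; split; rewrite /= !in_itv/= => /andP[h1 h2]; apply/andP; split; lra.
rewrite !lebesgue_measure_itv/= !lte_fin ltrD2r.
by case: ifP => // _; rewrite -!EFinB; congr (_%:E); ring.
Qed.

Lemma ge0_integral_shift (a : R) (f : R -> \bar R) :
  measurable_fun [set: R] f -> (forall x, 0 <= f x) ->
  \int[mu]_x f (x - a)%R = \int[mu]_x f x.
Proof.
move=> mf f0.
have mphi : measurable_fun setT ((fun x => (x - a)%R) : _ -> measurableTypeR R).
  exact: measurable_funB.
transitivity (\int[pushforward mu ((fun x => (x - a)%R) : _ -> measurableTypeR R)]_x f x).
  by rewrite ge0_integral_pushforward.
by apply: eq_measure_integral => A mA _; exact: lebesgue_measure_shift.
Qed.

End lebesgue_shift.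

Section gaussian_integral.
Context {R : realType}.
Local Notation mu := (@lebesgue_measure R).
Local Notation N := (@normal_prob R 0 1).
Local Notation phi := (@normal_pdf R 0 1).

(** The Radon-Nikodym derivative of [normal_prob] with respect to Lebesgue measure agrees almost
    everywhere with [normal_pdf], as both have the same integral over every measurable set. *)
Lemma ge0_integral_normal (f : R -> \bar R) : measurable_fun setT f ->
  (forall x, 0 <= f x)%E ->
  (\int[N]_x f x = \int[mu]_x (f x * (phi x)%:E))%E.
Proof.
move=> mf f0.
have dom := @normal_prob_dominates R 0 1.
rewrite -(Radon_Nikodym_SigmaFinite.change_of_variables dom)//.
apply: ae_eq_integral => //.
- apply: emeasurable_funM => //.
  by apply: (measurable_int mu); exact: Radon_Nikodym_SigmaFinite.f_integrable.
- apply: emeasurable_funM => //; apply/measurable_EFinP.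
  exact: measurable_normal_pdf.
- apply: ae_eqe_mul2l.
  apply: integral_ae_eq => //.
  + exact: Radon_Nikodym_SigmaFinite.f_integrable.
  + by apply/measurable_EFinP; exact: measurable_normal_pdf.
  + by move=> E _ mE; rewrite -Radon_Nikodym_SigmaFinite.f_integral.
Qed.

Lemma normal_pdf_shift (a x : R) :
  phi (x + a) = phi x * expR (- (a * x) - a ^+ 2 / 2).
Proof.
rewrite /normal_pdf oner_eq0 /normal_fun -mulrA -expRD.
by congr (_ * expR _); rewrite !subr0 expr1n; field.
Qed.

(** One-dimensional Cameron-Martin formula: translation invariance of Lebesgue measure moves the
    shift from [f] to the density, and [normal_pdf_shift] gives the ratio. *)
Lemma ge0_integral_normal_shift (a : R) (f : R -> \bar R) :
  measurable_fun setT f -> (forall x, 0 <= f x)%E ->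
  (\int[N]_x f (x - a)%R =
   \int[N]_x (f x * (expR (- (a * x) - a ^+ 2 / 2))%:E))%E.
Proof.
move=> mf f0.
have mpdf b : measurable_fun setT (fun x : R => (phi (x + b))%:E).
  apply/measurable_EFinP/(measurableT_comp (measurable_normal_pdf 0 1)).
  exact: measurable_funD.
have me : measurable_fun [set: R] (fun x => (expR (- (a * x) - a ^+ 2 / 2))%:E).
  apply/measurable_EFinP/measurableT_comp => //.
  by apply: measurable_funB => //; apply: measurable_funN; exact: measurable_funM.
rewrite !ge0_integral_normal//; last 3 first.
- exact: emeasurable_funM.
- by move=> x; rewrite mule_ge0// lee_fin expR_ge0.
- by apply: measurableT_comp => //; exact: measurable_funB.
rewrite -[RHS](ge0_integral_shift a); last 2 first.
- apply: emeasurable_funM; first exact: emeasurable_funM.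
  by have := mpdf 0; under eq_fun do rewrite addr0.
- by move=> x; rewrite !mule_ge0// lee_fin ?expR_ge0 ?normal_pdf_ge0.
apply: eq_integral => x _.
rewrite -muleA; congr (_ * _)%E; rewrite -EFinM mulrC -normal_pdf_shift.
by rewrite subrK.
Qed.

(** No Gaussian integral is computed: the shift formula for the constant 1, with shift [- c], says
    that the density ratio has total mass 1. *)
Lemma integral_normal_expR (c : R) :
  (\int[N]_x (expR (c * x))%:E = (expR (c ^+ 2 / 2))%:E)%E.
Proof.
have := @ge0_integral_normal_shift (- c) (cst 1%E) (measurable_cst _) (fun=> lee01).
rewrite integral_cst//= mul1e probability_setT => h.
have -> : (\int[N]_x (expR (c * x))%:E =
    \int[N]_x ((expR (c ^+ 2 / 2))%:E *
      (1 * (expR (- (- c * x) - (- c) ^+ 2 / 2))%:E)))%E.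
  apply: eq_integral => x _; rewrite mul1e -EFinM -expRD.
  by congr (expR _)%:E; rewrite sqrrN; lra.
rewrite ge0_integralZl//=; first by rewrite -h mule1.
- apply: emeasurable_funM => //; apply/measurable_EFinP/measurableT_comp => //.
  by apply: measurable_funB => //; apply: measurable_funN; exact: measurable_funM.
Qed.

End gaussian_integral.

Section gaussian_moments.
Context {R : realType}.
Local Notation N := (@normal_prob R 0 1).

Lemma expR_sub1Dx_le (y : R) : `|expR y - 1 - y| <= y ^+ 2 * expR `|y|.
Proof.
have h1 := expR_ge1Dx y.
have h2 := expR_ge1Dx (- y).
have h3 : expR y - 1 <= y * expR y.
  have : (1 - y) * expR y <= expR (- y) * expR y by rewrite ler_wpM2r ?expR_ge0.
  by rewrite -expRD addNr expR0; lra.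
rewrite ger0_norm; last lra.
have [y0|y0] := leP 0 y.
  rewrite ger0_norm// expr2 -mulrA.
  have := ler_wpM2l y0 h3; lra.
have e1 : 1 <= expR `|y|.
  by rewrite -[leLHS]expR0 ler_expR.
have : y ^+ 2 * 1 <= y ^+ 2 * expR `|y| by rewrite ler_wpM2l// sqr_ge0.
apply: le_trans; rewrite mulr1.
have : y * (expR y - 1) <= y * y by rewrite ler_wnM2l ?(ltW y0)//; lra.
by rewrite expr2; lra.
Qed.

Lemma expR_normr_le (c z : R) :
  expR (c * `|z|) <= expR (c * z) + expR (- c * z).
Proof.
have := expR_ge0 (c * z); have := expR_ge0 (- c * z).
by case: (ger0P z) => z0; rewrite ?mulrN ?mulNr; lra.
Qed.

(** The exponent 3 is the growth met in [stein_remainder]: one factor exp|z| from the function and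
    two from the Taylor remainder of the density ratio. The envelope lies below exp(3z) + exp(-3z),
    whose integral is known. *)
Lemma normal_integrable_exp (h : R -> R) (K : R) : measurable_fun setT h ->
  (forall z, `|h z| <= K * expR (3 * `|z|)) ->
  N.-integrable setT (EFin \o h).
Proof.
move=> mh hK.
have intE (c : R) : N.-integrable setT (EFin \o (fun z => K * expR (c * z))).
  apply: (@integrableZl _ _ _ N _ measurableT K (fun z => (expR (c * z))%:E)).
  apply/integrableP; split.
    by apply/measurable_EFinP/measurableT_comp => //; exact: measurable_funM.
  under eq_integral do rewrite /= ger0_norm ?expR_ge0//.
  by rewrite integral_normal_expR ltry.
apply: (le_integrable measurableT _ _ (integrableD measurableT (intE 3) (intE (-3)))).
  exact/measurable_EFinP.
move=> z _ /=; rewrite lee_fin.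
have K0 : 0 <= K.
  by have := le_trans (normr_ge0 _) (hK 0); rewrite pmulr_lge0// expR_gt0.
rewrite [leRHS]ger0_norm; last by rewrite addr_ge0// mulr_ge0// expR_ge0.
apply: (le_trans (hK z)); rewrite -mulrDr ler_wpM2l//.
exact: expR_normr_le.
Qed.

Lemma normal_Rintegral_exp (h : R -> R) (K : R) : measurable_fun setT h ->
  (forall z, `|h z| <= K * expR (3 * `|z|)) ->
  `|\int[N]_z h z| <= K * (2 * expR (9 / 2)).
Proof.
move=> mh hK; have ih := normal_integrable_exp mh hK.
have me (c : R) : measurable_fun setT (fun z => expR (c * z)).
  by apply/measurableT_comp => //; exact: measurable_funM.
have intE (c : R) : `|c| <= 3 -> N.-integrable setT (EFin \o (fun z => expR (c * z))).
  move=> c3; apply: (@normal_integrable_exp _ 1) => // z.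
  rewrite ger0_norm ?expR_ge0// mul1r ler_expR (le_trans (ler_norm _))//.
  by rewrite normrM ler_wpM2r.
have K0 : 0 <= K.
  by have := le_trans (normr_ge0 _) (hK 0); rewrite pmulr_lge0// expR_gt0.
apply: (le_trans (le_normr_Rintegral measurableT ih)).
have n3 : `|3 : R| <= 3 by rewrite ger0_norm.
have n3' : `|-3 : R| <= 3 by rewrite normrN ger0_norm.
have i3 := intE 3 n3; have i3' := intE (-3) n3'.
have iD : N.-integrable setT (EFin \o (fun z : R => expR (3 * z) + expR (-3 * z))).
  exact: (integrableD measurableT i3 i3').
apply: (@le_trans _ _ (\int[N]_z (K * (expR (3 * z) + expR (-3 * z))))).
  apply: le_Rintegral => //.
  - exact: (integrable_norm ih).
  - exact: (integrableZl measurableT K iD).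
  - move=> z _; apply: (le_trans (hK z)); rewrite ler_wpM2l//.
    exact: expR_normr_le.
rewrite RintegralZl// RintegralD// /Rintegral !integral_normal_expR/=.
have -> : (3 ^+ 2 : R) = 9 by ring.
by rewrite sqrrN (_ : (3 ^+ 2 : R) = 9) ?ler_wpM2l//; [lra|ring].
Qed.

Lemma sqr_le_expR (x : R) : 0 <= x -> x ^+ 2 <= 2 * expR x.
Proof.
move=> x0; have := expR_ge1Dxn 1 x0.
rewrite (_ : 2`!%:R = 2 :> R)//; lra.
Qed.

Lemma normal_integrable_shift (k : R -> R) (K a : R) : measurable_fun setT k ->
  (forall z, `|k z| <= K * expR `|z|) ->
  N.-integrable setT (EFin \o (fun z => k (z - a))).
Proof.
move=> mk kK; apply: (@normal_integrable_exp _ (K * expR `|a|)).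
  by apply: measurableT_comp => //; exact: measurable_funB.
have K0 : 0 <= K.
  by have := le_trans (normr_ge0 _) (kK 0); rewrite pmulr_lge0// expR_gt0.
move=> z; apply: (le_trans (kK _)); rewrite -mulrA ler_wpM2l// -expRD ler_expR.
by have := ler_normB z a; have := normr_ge0 z; lra.
Qed.

Lemma normal_weight_le (a z : R) : `|a| <= 1 ->
  expR (- (a * z) - a ^+ 2 / 2) <= expR `|z|.
Proof.
move=> a1; rewrite ler_expR; have := sqr_ge0 a.
have : - (a * z) <= `|z|.
  rewrite (le_trans (ler_norm _))// normrN normrM ler_piMl//.
lra.
Qed.

Lemma measurable_normal_weight (a : R) :
  measurable_fun [set: R] (fun z => expR (- (a * z) - a ^+ 2 / 2)).
Proof.
apply/measurableT_comp => //.
by apply: measurable_funB => //; apply: measurable_funN; exact: measurable_funM.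
Qed.

Lemma normal_integrable_weight (k : R -> R) (K a : R) : measurable_fun setT k ->
  `|a| <= 1 -> (forall z, `|k z| <= K * expR `|z|) ->
  N.-integrable setT (EFin \o (fun z => k z * expR (- (a * z) - a ^+ 2 / 2))).
Proof.
move=> mk a1 kK; apply: (@normal_integrable_exp _ K).
  by apply: measurable_funM => //; exact: measurable_normal_weight.
have K0 : 0 <= K.
  by have := le_trans (normr_ge0 _) (kK 0); rewrite pmulr_lge0// expR_gt0.
move=> z; rewrite normrM [X in _ * X]ger0_norm ?expR_ge0//.
apply: le_trans (ler_pM (normr_ge0 _) (expR_ge0 _) (kK z) (normal_weight_le z a1)) _.
rewrite -mulrA -expRD ler_wpM2l// ler_expR; have := normr_ge0 z; lra.
Qed.

(** A signed [k] is the difference of the nonnegative functions [k1 = k + e] and [e], with [e] its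
    growth envelope; the nonnegative formula applies to each. *)
Lemma Rintegral_normal_shift (k : R -> R) (K a : R) : measurable_fun setT k ->
  `|a| <= 1 -> (forall z, `|k z| <= K * expR `|z|) ->
  \int[N]_z k (z - a) = \int[N]_z (k z * expR (- (a * z) - a ^+ 2 / 2)).
Proof.
move=> mk a1 kK.
have K0 : 0 <= K.
  by have := le_trans (normr_ge0 _) (kK 0); rewrite pmulr_lge0// expR_gt0.
pose e (z : R) : R := K * expR `|z|.
have me : measurable_fun setT e.
  by apply: measurable_funM => //; apply/measurableT_comp => //; exact: normr_measurable.
have eK z : `|e z| <= K * expR `|z| by rewrite ger0_norm// mulr_ge0 ?expR_ge0.
pose k1 z := k z + e z.
have mk1 : measurable_fun setT k1 by exact: measurable_funD.
have k1K z : `|k1 z| <= (K + K) * expR `|z|.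
  by rewrite (le_trans (ler_normD _ _))// mulrDl lerD.
have shift0 (h : R -> R) : measurable_fun setT h -> (forall z, 0 <= h z) ->
    \int[N]_z h (z - a) = \int[N]_z (h z * expR (- (a * z) - a ^+ 2 / 2)).
  move=> mh h0; rewrite /Rintegral.
  rewrite (@ge0_integral_normal_shift _ a (EFin \o h))//.
  exact/measurable_EFinP.
have k10 z : 0 <= k1 z by have := kK z; rewrite /k1 ler_norml => /andP[]; rewrite /e; lra.
have e0 z : 0 <= e z by rewrite mulr_ge0 ?expR_ge0.
transitivity (\int[N]_z (k1 (z - a) - e (z - a))).
  by apply: eq_Rintegral => z _; rewrite /k1; lra.
rewrite RintegralB//; [|exact: normal_integrable_shift k1K|exact: normal_integrable_shift eK].
rewrite !shift0// -RintegralB//.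
- by apply: eq_Rintegral => z _; rewrite /k1; lra.
- exact: normal_integrable_weight k1K.
- exact: normal_integrable_weight eK.
Qed.

(** Product of [3 * expR 1], from the pointwise bound in [stein_remainder], and [2 * expR (9 / 2)],
    from integrating exp(3|z|). *)
Definition stein_cst : R := 6 * expR (11 / 2).

(* By the Gaussian density ratio, shifting by [a] is weighting by
   [expR (- (a * z) - a ^+ 2 / 2)], which is [1 - a * z] up to order [a ^+ 2]. *)
Lemma stein_remainder (k : R -> R) (K a : R) : measurable_fun setT k ->
  `|a| <= 1 -> (forall z, `|k z| <= K * expR `|z|) ->
  `|\int[N]_z (k z - k (z - a) - a * (k z * z))| <= stein_cst * K * a ^+ 2.
Proof.
move=> mk a1 kK.
have K0 : 0 <= K.
  by have := le_trans (normr_ge0 _) (kK 0); rewrite pmulr_lge0// expR_gt0.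
have zE (z : R) : `|z| <= expR `|z| by have := expR_ge1Dx `|z|; lra.
have e23 (z : R) : expR `|z| * expR `|z| <= expR (3 * `|z|).
  by rewrite -expRD ler_expR; have := normr_ge0 z; lra.
have e13 (z : R) : expR `|z| <= expR (3 * `|z|).
  by rewrite ler_expR; have := normr_ge0 z; lra.
have ik : N.-integrable setT (EFin \o k).
  apply: (@normal_integrable_exp _ K) => // z; apply: (le_trans (kK z)).
  by rewrite ler_wpM2l.
have mkz : measurable_fun setT (fun z => k z * z) by exact: measurable_funM.
have ikz : N.-integrable setT (EFin \o (fun z => k z * z)).
  apply: (@normal_integrable_exp _ K) => // z; rewrite normrM.
  apply: le_trans (ler_pM (normr_ge0 _) (normr_ge0 _) (kK z) (zE z)) _.
  by rewrite -mulrA ler_wpM2l.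
have iakz : N.-integrable setT (EFin \o (fun z => a * (k z * z))).
  exact: (integrableZl measurableT a ikz).
have iks := normal_integrable_shift a mk kK.
have ikw := normal_integrable_weight mk a1 kK.
have -> : \int[N]_z (k z - k (z - a) - a * (k z * z)) =
    \int[N]_z (k z - k z * expR (- (a * z) - a ^+ 2 / 2) - a * (k z * z)).
  rewrite !RintegralB//; last 2 first.
  - exact: (integrableB measurableT ik ikw).
  - exact: (integrableB measurableT ik iks).
  by rewrite (Rintegral_normal_shift mk a1 kK).
have -> : stein_cst * K * a ^+ 2 = (3 * expR 1 * K * a ^+ 2) * (2 * expR (9 / 2)).
  rewrite /stein_cst (_ : 11 / 2 = 1 + 9 / 2); last by lra.
  by rewrite expRD; ring.
apply: normal_Rintegral_exp.
  apply: measurable_funB; last exact: measurable_funM.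
  apply: measurable_funB => //; apply: measurable_funM => //.
  exact: measurable_normal_weight.
move=> z; set y := - (a * z) - a ^+ 2 / 2.
(* The terms linear in [a] cancel, leaving the second-order Taylor remainder of exp at [y] and the
   constant [a ^+ 2 / 2], both of order [a ^+ 2]. *)
have -> : k z - k z * expR y - a * (k z * z) = - (k z * ((expR y - 1 - y) - a ^+ 2 / 2)).
  by rewrite {3}/y; ring.
rewrite normrN normrM.
have az : `|a * z| <= `|z| by rewrite normrM ler_piMl.
have a2 : a ^+ 2 <= 1 by rewrite -real_normK ?num_real// expr_le1.
have yz : `|y| <= `|z| + 1 / 2.
  apply: (le_trans (ler_normB _ _)); rewrite normrN.
  by rewrite (ger0_norm (_ : 0 <= a ^+ 2 / 2)) ?divr_ge0 ?sqr_ge0//; lra.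
have y2 : y ^+ 2 <= a ^+ 2 * (`|z| + 1 / 2) ^+ 2.
  have -> : y = - a * (z + a / 2) by rewrite /y; ring.
  rewrite exprMn sqrrN ler_wpM2l ?sqr_ge0// -real_normK ?num_real// ler_sqr ?nnegrE//.
  - apply: (le_trans (ler_normD _ _)); rewrite lerD2l normrM.
    by rewrite (ger0_norm (_ : 0 <= 2^-1)) ?invr_ge0//; lra.
have y2' : y ^+ 2 <= a ^+ 2 * (2 * expR (`|z| + 1 / 2)).
  apply: (le_trans y2); rewrite ler_wpM2l ?sqr_ge0//; apply: sqr_le_expR.
  by have := normr_ge0 z; lra.
have ey : expR `|y| <= expR (`|z| + 1 / 2) by rewrite ler_expR.
have b1 : `|expR y - 1 - y| <= a ^+ 2 * (2 * expR (2 * `|z| + 1)).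
  apply: (le_trans (expR_sub1Dx_le y)).
  apply: le_trans (ler_pM (sqr_ge0 _) (expR_ge0 _) y2' ey) _.
  rewrite (_ : expR (2 * `|z| + 1) = expR (`|z| + 1 / 2) * expR (`|z| + 1 / 2)).
    lra.
  by rewrite -expRD; congr expR; lra.
have b2 : `|a ^+ 2 / 2| <= a ^+ 2 * expR (2 * `|z| + 1).
  rewrite ger0_norm ?divr_ge0 ?sqr_ge0// ler_wpM2l ?sqr_ge0//.
  apply: (@le_trans _ _ 1); first lra.
  by rewrite -[leLHS]expR0 ler_expR; have := normr_ge0 z; lra.
have b3 : `|expR y - 1 - y - a ^+ 2 / 2| <= 3 * a ^+ 2 * expR (2 * `|z| + 1).
  by apply: (le_trans (ler_normB _ _)); apply: le_trans (lerD b1 b2) _; lra.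
apply: le_trans (ler_pM (normr_ge0 _) (normr_ge0 _) (kK z) b3) _.
rewrite (_ : 3 * `|z| = `|z| + 2 * `|z|); last by lra.
rewrite !expRD; lra.
Qed.

End gaussian_moments.

Section gaussian_lipschitz.
Context {R : realType}.
Local Notation N := (@normal_prob R 0 1).
Local Notation C := (@stein_cst R).

Lemma stein_cst_ge2 : 2 <= C.
Proof.
rewrite /stein_cst; have : 1 <= expR (11 / 2 : R) by rewrite -[leLHS]expR0 ler_expR; lra.
lra.
Qed.

Lemma normr_le_expR (z : R) : `|z| <= expR `|z|.
Proof. by have := expR_ge1Dx `|z|; lra. Qed.

Lemma normal_Rintegral_cst (c : R) : \int[N]_z c = c.
Proof.
transitivity (c * fine (1%E : \bar R)); last by rewrite mulr1.
by rewrite Rintegral_cst//; congr (_ * fine _); exact: (probability_setT N).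
Qed.

Lemma normal_integrable_expX (n : nat) : N.-integrable setT (EFin \o (fun z : R => z ^+ n)).
Proof.
apply: (@normal_integrable_exp _ _ n`!%:R).
  exact: measurable_funX.
move=> z; rewrite normrX.
apply: (@le_trans _ _ (n`!%:R * expR `|z|)); last first.
  by rewrite ler_wpM2l ?ler0n// ler_expR; have := normr_ge0 z; lra.
rewrite mulrC -ler_pdivrMr ?ltr0n ?fact_gt0//.
case: n => [|n]; first by rewrite expr0 fact0 divr1 -expR0 ler_expR.
by have := expR_ge1Dxn n (normr_ge0 z); lra.
Qed.

(** Dividing by [a] and letting [a] tend to 0, without a limit: if [y < x], the step
    [a = min(1, (x - y) / (|K| + 1))] already contradicts the hypothesis. *)
Lemma ler_eps_sqr (x y K : R) :
  (forall a, 0 < a -> a <= 1 -> a * x <= a * y + K * a ^+ 2) -> x <= y.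
Proof.
move=> h; rewrite leNgt; apply/negP => yx.
pose K' := `|K| + 1.
have K'0 : 0 < K' by rewrite /K'; have := normr_ge0 K; lra.
have KK' : K < K' by rewrite /K'; have := ler_norm K; lra.
pose a := Num.min 1 ((x - y) / K').
have a0 : 0 < a by rewrite lt_min ltr01 divr_gt0// subr_gt0.
have a1 : a <= 1 by rewrite ge_min lexx.
have aK : a * K' <= x - y by rewrite -ler_pdivlMr// ge_min lexx orbT.
have := h a a0 a1.
have -> : a * y + K * a ^+ 2 = a * (y + K * a) by ring.
rewrite ler_pM2l// => h1.
have : K * a < K' * a by rewrite ltr_pM2r.
lra.
Qed.

Lemma normal_integrable_id : N.-integrable setT (EFin \o (fun z : R => z)).
Proof. by have := normal_integrable_expX 1. Qed.

(** The moments come from Stein's estimate at powers of [z]. At [k = 1] the finite difference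
    vanishes, so a E Z = O(a^2). *)
Lemma normal_mean : \int[N]_z z = 0.
Proof.
have i1 := normal_integrable_id.
have h (a : R) : 0 < a -> a <= 1 -> `|a * \int[N]_z z| <= C * 1 * a ^+ 2.
  move=> a0 a1; rewrite -normrN -mulNr -RintegralZl//.
  have -> : \int[N]_z (- a * z) = \int[N]_z (1 - 1 - a * (1 * z)).
    by apply: eq_Rintegral => z _; ring.
  apply: (@stein_remainder _ (cst 1)) => //; first by rewrite gtr0_norm.
  by move=> z; rewrite mul1r normr1 -[leLHS]expR0 ler_expR.
apply/eqP; rewrite eq_le; apply/andP; split; apply: (@ler_eps_sqr _ _ (C * 1)) => a a0 a1.
- by rewrite mulr0 add0r; apply: le_trans (h a a0 a1); exact: ler_norm.
- rewrite mulr0; have := h a a0 a1; rewrite ler_norml => /andP[]; lra.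
Qed.

(** At [k = id] the finite difference is exactly [a], so a (1 - E Z^2) = O(a^2); only an upper bound
    is kept. *)
Lemma normal_second_moment : \int[N]_z (z ^+ 2) <= 1.
Proof.
apply: (@ler_eps_sqr _ _ (C * 1)) => a a0 a1; rewrite mulr1.
have i2 := normal_integrable_expX 2.
have : `|\int[N]_z (z - (z - a) - a * (z * z))| <= C * 1 * a ^+ 2.
  apply: (@stein_remainder _ (fun z : R => z)) => //; first by rewrite gtr0_norm.
  by move=> z; rewrite mul1r normr_le_expR.
have -> : \int[N]_z (z - (z - a) - a * (z * z)) = \int[N]_z (a - a * z ^+ 2).
  by apply: eq_Rintegral => z _; ring.
rewrite RintegralB//; last 2 first.
- exact: finite_measure_integrable_cst.
- exact: (integrableZl measurableT a i2).
rewrite RintegralZl// normal_Rintegral_cst ler_norml.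
by move=> /andP[]; lra.
Qed.

(** At [k = z^3] the leading part of the finite difference is 3 a z^2, whence E Z^4 <= 3 E Z^2. *)
Lemma normal_fourth_moment : \int[N]_z (z ^+ 4) <= 3.
Proof.
have m2 := normal_second_moment.
apply: (@ler_eps_sqr _ _ (C * 6 + 1)) => a a0 a1.
have i1 := normal_integrable_id.
have i2 := normal_integrable_expX 2.
have i4 := normal_integrable_expX 4.
have : `|\int[N]_z (z ^+ 3 - (z - a) ^+ 3 - a * (z ^+ 3 * z))| <= C * 6 * a ^+ 2.
  apply: (@stein_remainder _ (fun z : R => z ^+ 3)) => //.
  - by rewrite gtr0_norm.
  - move=> z; rewrite normrX; have := expR_ge1Dxn 2 (normr_ge0 z).
    by rewrite (_ : 3`!%:R = 6 :> R)//; lra.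
have -> : \int[N]_z (z ^+ 3 - (z - a) ^+ 3 - a * (z ^+ 3 * z)) =
    \int[N]_z (a ^+ 3 - 3 * a ^+ 2 * z + 3 * a * z ^+ 2 - a * z ^+ 4).
  by apply: eq_Rintegral => z _; ring.
have j1 := integrableZl measurableT (3 * a ^+ 2) i1.
have j2 := integrableZl measurableT (3 * a) i2.
have j4 := integrableZl measurableT a i4.
have j0 : N.-integrable setT (EFin \o cst (a ^+ 3)) by exact: finite_measure_integrable_cst.
have j01 := integrableB measurableT j0 j1.
have j012 := integrableD measurableT j01 j2.
rewrite RintegralB// RintegralD// RintegralB// normal_Rintegral_cst !RintegralZl//.
rewrite normal_mean mulr0 subr0 ler_norml => /andP[+ _].
have a3 : a ^+ 3 <= a ^+ 2 by rewrite exprS ler_piMl// sqr_ge0.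
have : 3 * a * \int[N]_z (z ^+ 2) <= 3 * a * 1 by rewrite ler_wpM2l//; lra.
lra.
Qed.

Lemma lipschitz_growth (k : R -> R) (L : R) : 0 <= L ->
  (forall z z', `|k z - k z'| <= L * `|z - z'|) ->
  forall z, `|k z| <= (`|k 0| + L) * expR `|z|.
Proof.
move=> L0 kL z; have := kL z 0; rewrite subr0 => h.
have : `|k z| <= `|k 0| + L * `|z|.
  rewrite -[k z](subrK (k 0)) addrC (le_trans (ler_normD _ _))// lerD2l//.
move=> /le_trans; apply; rewrite mulrDl lerD// ?ler_wpM2l ?normr_le_expR//.
by rewrite ler_peMr// -[leLHS]expR0 ler_expR.
Qed.

Lemma stein_integrable (k : R -> R) (L a : R) : measurable_fun setT k -> 0 <= L ->
  (forall z z', `|k z - k z'| <= L * `|z - z'|) ->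
  N.-integrable setT (EFin \o (fun z => k z - k (z - a) - a * (k z * z))).
Proof.
move=> mk L0 kL; have kK := lipschitz_growth L0 kL.
have e13 (z : R) : expR `|z| <= expR (3 * `|z|).
  by rewrite ler_expR; have := normr_ge0 z; lra.
have e23 (z : R) : expR `|z| * expR `|z| <= expR (3 * `|z|).
  by rewrite -expRD ler_expR; have := normr_ge0 z; lra.
have K0 : 0 <= `|k 0| + L by rewrite addr_ge0.
have ik : N.-integrable setT (EFin \o k).
  apply: (@normal_integrable_exp _ _ (`|k 0| + L)) => // z.
  by apply: (le_trans (kK z)); rewrite ler_wpM2l.
have ikz : N.-integrable setT (EFin \o (fun z => k z * z)).
  apply: (@normal_integrable_exp _ _ (`|k 0| + L)); first exact: measurable_funM.
  move=> z; rewrite normrM.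
  apply: le_trans (ler_pM (normr_ge0 _) (normr_ge0 _) (kK z) (normr_le_expR z)) _.
  by rewrite -mulrA ler_wpM2l.
exact: (integrableB measurableT
  (integrableB measurableT ik (normal_integrable_shift a mk kK))
  (integrableZl measurableT a ikz)).
Qed.

Lemma stein_lipschitz (k : R -> R) (L a : R) : measurable_fun setT k -> 0 <= L ->
  (forall z z', `|k z - k z'| <= L * `|z - z'|) ->
  `|\int[N]_z (k z - k (z - a) - a * (k z * z))| <= C * L * a ^+ 2.
Proof.
move=> mk L0 kL; pose h z := k z - k 0.
have hz z : `|h z| <= L * `|z| by have := kL z 0; rewrite subr0.
have hE z : `|h z| <= L * expR `|z|.
  by apply: (le_trans (hz z)); rewrite ler_wpM2l// normr_le_expR.
have mh : measurable_fun setT h by exact: measurable_funB.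
have i1 := normal_integrable_id.
have i2 := normal_integrable_expX 2.
have mhz : measurable_fun setT (fun z => h z * z) by exact: measurable_funM.
have ihz : N.-integrable setT (EFin \o (fun z => h z * z)).
  apply: (le_integrable measurableT _ _ (integrableZl measurableT L i2)).
    exact/measurable_EFinP.
  move=> z _; rewrite /= lee_fin !normrM (ger0_norm L0) mulrA.
  by rewrite ler_wpM2r.
have ih : N.-integrable setT (EFin \o h).
  apply: (@normal_integrable_exp _ _ L) => // z; apply: (le_trans (hE z)).
  by rewrite ler_wpM2l// ler_expR; have := normr_ge0 z; lra.
have ihs := normal_integrable_shift a mh hE.
have iahz := integrableZl measurableT a ihz.
have ibhz := integrableB measurableT (integrableB measurableT ih ihs) iahz.
have -> : \int[N]_z (k z - k (z - a) - a * (k z * z)) =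
    \int[N]_z (h z - h (z - a) - a * (h z * z)).
  transitivity (\int[N]_z ((h z - h (z - a) - a * (h z * z)) - a * k 0 * z)).
    by apply: eq_Rintegral => z _; rewrite /h; ring.
  rewrite RintegralB//; last exact: (integrableZl measurableT (a * k 0) i1).
  by rewrite RintegralZl// normal_mean mulr0 subr0.
have [a1|a1] := leP `|a| 1; first exact: stein_remainder.
rewrite RintegralB//; last exact: (integrableB measurableT ih ihs).
rewrite RintegralZl//.
have b1 : `|\int[N]_z (h z - h (z - a))| <= L * `|a|.
  apply: le_trans (le_normr_Rintegral measurableT (integrableB measurableT ih ihs)) _.
  rewrite -[leRHS]normal_Rintegral_cst.
  apply: le_Rintegral => //.
  - exact: (integrable_norm (integrableB measurableT ih ihs)).
  - exact: finite_measure_integrable_cst.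
  - move=> z _; rewrite /h opprB addrA subrK.
    by have := kL z (z - a); rewrite subKr.
have b2 : `|a * \int[N]_z (h z * z)| <= `|a| * L.
  rewrite normrM ler_wpM2l//; apply: le_trans (le_normr_Rintegral measurableT ihz) _.
  apply: (@le_trans _ _ (\int[N]_z (L * z ^+ 2))).
    apply: le_Rintegral => //.
    - exact: (integrable_norm ihz).
    - exact: (integrableZl measurableT L i2).
    - move=> z _; rewrite normrM -(real_normK (num_real z)) expr2 mulrA.
      by rewrite ler_wpM2r.
  rewrite RintegralZl// -[leRHS]mulr1 ler_wpM2l//; exact: normal_second_moment.
have aa : `|a| <= a ^+ 2.
  by rewrite -(real_normK (num_real a)) expr2 ler_peMr// ltW.
have : 2 * L * a ^+ 2 <= C * L * a ^+ 2.
  by rewrite ler_wpM2r ?sqr_ge0// ler_wpM2r// stein_cst_ge2.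
apply: le_trans; apply: (le_trans (ler_normB _ _)).
apply: (le_trans (lerD b1 b2)).
have : L * `|a| <= L * a ^+ 2 by rewrite ler_wpM2l.
lra.
Qed.

End gaussian_lipschitz.

(** * Measurability of maps into and out of R^n *)

Section measurable_row_vectors.
Context {R : realType}.

(** An open set is the countable union of the rational boxes it contains, and the preimage of a box
    is a finite intersection of preimages of intervals. The domain is an arbitrary measurable space
    so that it can be a sigma-algebra omitting one noise coordinate. *)
Lemma measurable_fun_continuous_rV d (T : measurableType d) (n : nat)
    (X : T -> 'rV[R]_n) (f : 'rV[R]_n -> R) :
  (forall i, measurable_fun setT (fun w => X w ord0 i)) ->
  continuous f -> measurable_fun setT (f \o X).
Proof.
move=> mX cf.
suff mU (U : set 'rV[R]_n) : open U -> measurable (X @^-1` U).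
  apply: (measurability _ (RGenOpens.measurableE R)).
  move=> _ [_ [a [b ->] <-]]; rewrite setTI comp_preimage; apply: mU.
  by apply: open_comp => // x _; exact: cf.
move=> oU.
pose box (r : {ffun 'I_n -> rat * rat}) : set 'rV[R]_n :=
  [set x | forall i, ratr (r i).1 < x ord0 i < ratr (r i).2].
have mbox r : measurable (X @^-1` box r).
  have -> : X @^-1` box r = \bigcap_(i in [set: 'I_n])
      (fun w => X w ord0 i) @^-1` `](ratr (r i).1), (ratr (r i).2)[%classic.
    apply/seteqP; split => [w h i _|w h i]; first by rewrite /= in_itv /=; exact: h.
    by have := h i I; rewrite /= in_itv.
  apply: fin_bigcap_measurable => // i _.
  by rewrite -[X in measurable X]setTI; apply: mX.
have -> : X @^-1` U = \bigcup_(r in [set r | box r `<=` U]) X @^-1` box r.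
  apply/seteqP; split => [w Uw|w [r rU rw]]; last exact: rU.
  have /nbhs_ballP[e e0 eU] := open_nbhs_nbhs (conj oU Uw).
  have lo i : exists q : rat, X w ord0 i - e < ratr q < X w ord0 i.
    have /rat_in_itvoo[q] : X w ord0 i - e < X w ord0 i by rewrite gtrBl.
    by rewrite in_itv; exists q.
  have hi i : exists q : rat, X w ord0 i < ratr q < X w ord0 i + e.
    have /rat_in_itvoo[q] : X w ord0 i < X w ord0 i + e by rewrite ltrDl.
    by rewrite in_itv; exists q.
  have [p pP] := choice lo; have [q qP] := choice hi.
  exists [ffun i => (p i, q i)].
    move=> y hy; apply: eU; split=> // i j; rewrite ord1.
    have := hy j; rewrite ffunE /= => /andP[h1 h2].
    have /andP[h3 _] := pP j; have /andP[_ h4] := qP j.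
    rewrite /ball/= ltr_norml; apply/andP; split; lra.
  move=> i; rewrite ffunE /=.
  by have /andP[_ ->] := pP i; have /andP[-> _] := qP i.
rewrite bigcup_mkcond; apply: countable_bigcupT_measurable.
  exact: countableP.
by move=> r; case: ifP.
Qed.

Lemma random_vector_coord d (T : measurableType d) (n : nat) (X : T -> 'rV[R]_n) (i : 'I_n) :
  random_vector X -> measurable_fun setT (fun w => X w ord0 i).
Proof.
move=> mX; apply: (measurability _ (RGenOpens.measurableE R)).
move=> _ [_ [a [b ->] <-]]; rewrite setTI.
apply: (mX ((fun x : 'rV[R]_n => x ord0 i) @^-1` `]a, b[%classic)).
apply: sub_sigma_algebra; apply: open_comp => // x _.
exact: coord_continuous.
Qed.

End measurable_row_vectors.

(** * Independence and freezing *)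

Section coordinate_independence.
Context {R : realType}.

Lemma borel_set_coord n (i : 'I_n) (A : set R) : measurable A ->
  borel_set ((fun x : 'rV[R]_n => x ord0 i) @^-1` A).
Proof.
move=> mA; pose T := g_sigma_algebraType (@open 'rV[R]_n).
have h : measurable_fun [set: T] (fun x : T => (x : 'rV[R]_n) ord0 i).
  by apply: (@random_vector_coord R _ T n id i) => B bB; rewrite preimage_id.
by have := h measurableT A mA; rewrite setTI.
Qed.

Lemma borel_set_box n (B : 'I_n -> set R) : (forall i, measurable (B i)) ->
  borel_set [set x : 'rV[R]_n | forall i, B i (x ord0 i)].
Proof.
move=> mB; pose T := g_sigma_algebraType (@open 'rV[R]_n).
have -> : [set x : 'rV[R]_n | forall i, B i (x ord0 i)] =
    \bigcap_(i in [set: 'I_n]) (fun x : 'rV[R]_n => x ord0 i) @^-1` B i.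
  by apply/seteqP; split => [x h i _|x h i]; [exact: h|exact: (h i I)].
apply: (@fin_bigcap_measurable _ T) => // i _.
exact: borel_set_coord.
Qed.

(** Independence is given in two layers, between times and between the coordinates at one time.
    Padding [J] to the full rectangle of times below [m], with the trivial condition [setT] off [J],
    lets both product rules apply in turn; the padded factors equal 1. *)
Lemma iid_gaussian_coord_independent d (T : measurableType d) (P : probability T R)
    n (u : nat -> T -> 'rV[R]_n) : iid_standard_gaussian P u ->
  mutually_independent P [set A : set R | measurable A]
    (fun (p : nat * 'I_n) w => u p.1 w ord0 p.2).
Proof.
move=> [gu iu] J B uJ mB.
pose B' p := if p \in J then B p else [set: R].
have mB' p : measurable (B' p).
  by rewrite /B'; case: ifPn => // pJ; exact: mB.
pose m := (\max_(p <- J) p.1).+1.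
have Jm p : p \in J -> (p.1 < m)%N.
  by move=> pJ; rewrite ltnS; exact: leq_bigmax_seq.
pose K t : set 'rV[R]_n := [set x | forall i, B' (t, i) (x ord0 i)].
have -> : \bigcap_(p in [set` J]) (fun w => u p.1 w ord0 p.2) @^-1` B p =
    \bigcap_(t in [set` iota 0 m]) u t @^-1` K t.
  apply/seteqP; split => [w h t _ i|w h [t i] pJ].
    by rewrite /B'; case: ifPn => // pJ; exact: h.
  have tm : t \in iota 0 m by rewrite mem_iota add0n; exact: (Jm _ pJ).
  by have := h t tm i; rewrite /B' (pJ : (t, i) \in J).
rewrite iu ?iota_uniq//; last by move=> t _; exact: (@borel_set_box n (fun i => B' (t, i))).
have PK t : P (u t @^-1` K t) =
    (\prod_(i <- enum 'I_n) P ((fun w => u t w ord0 i) @^-1` B' (t, i)))%E.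
  have [_ _ it] := gu t.
  rewrite -it ?enum_uniq//; last by move=> i _; exact: mB'.
  congr (P _); apply/seteqP; split => [w h i _|w h i]; first exact: h.
  by apply: h; rewrite /= mem_enum.
under eq_bigr do rewrite PK.
have -> : (\prod_(p <- J) P ((fun w => u p.1 w ord0 p.2) @^-1` B p) =
    \prod_(p <- J) P ((fun w => u p.1 w ord0 p.2) @^-1` B' p))%E.
  by apply: eq_big_seq => p pJ; rewrite /B' pJ.
pose s := [seq (t, i) | t <- iota 0 m, i <- enum 'I_n].
transitivity (\prod_(p <- s) P ((fun w => u p.1 w ord0 p.2) @^-1` B' p))%E.
  by rewrite big_allpairs_dep.
have us : uniq s.
  by apply: allpairs_uniq; rewrite ?iota_uniq ?enum_uniq// => -[? ?] [? ?] _ _ /= ->.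
rewrite (bigID [pred p | p \in J])/= [X in (_ * X)%E]big1 ?mule1; last first.
  move=> p pJ; rewrite /B' (negbTE pJ) preimage_setT.
  exact: probability_setT.
rewrite -big_filter; apply: perm_big; apply: uniq_perm => //.
  exact: filter_uniq.
move=> [t i]; rewrite mem_filter /=; have [pJ|//] := boolP ((t, i) \in J).
rewrite /=; apply/allpairsPdep; exists t, i; split => //.
  by rewrite mem_iota add0n /=; exact: (Jm _ pJ).
by rewrite mem_enum.
Qed.

End coordinate_independence.

Section freezing.
Context d (T : measurableType d) {R : realType} (P : probability T R).
Context (I : eqType) (X : I -> T -> R).
Hypothesis mX : forall i, measurable_fun setT (X i).
Hypothesis iX : mutually_independent P [set A : set R | measurable A] X.
Variable p : I.
Local Notation N := (@normal_prob R 0 1).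
Local Notation RR := (measurableTypeR R).
Hypothesis gX : forall A, measurable A -> P (X p @^-1` A) = N A.

(* Generates the sigma-algebra [G] of all coordinates except [p]: being
   [G]-measurable is how "does not depend on [X p]" is expressed. *)
Definition cylinders_off (X : I -> T -> R) (p : I) : set (set T) :=
  [set E | exists (J : seq I) (B : I -> set R), [/\ uniq J, p \notin J,
     forall i, i \in J -> measurable (B i) &
     E = \bigcap_(i in [set` J]) (X i @^-1` B i)]].

Local Notation G := (g_sigma_algebraType (cylinders_off X p)).

Lemma measurable_coord_off (i : I) : i != p ->
  measurable_fun [set: G] (X i : G -> R).
Proof.
move=> ip _ A mA; rewrite setTI; apply: sub_sigma_algebra.
exists [:: i], (fun=> A); split=> //; first by rewrite inE eq_sym.
apply/seteqP; split => [w h j|w h].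
  by rewrite /= inE => /eqP ->.
by apply: h; rewrite /= inE.
Qed.

Lemma setI_closed_cylinders_off : setI_closed (cylinders_off X p).
Proof.
move=> _ _ [J1 [B1 [u1 p1 m1 ->]]] [J2 [B2 [u2 p2 m2 ->]]].
exists (undup (J1 ++ J2)), (fun i => (if i \in J1 then B1 i else setT) `&`
  (if i \in J2 then B2 i else setT)); split.
- exact: undup_uniq.
- by rewrite mem_undup mem_cat negb_or p1.
- by move=> i _; apply: measurableI; case: ifPn => // ij; [exact: m1|exact: m2].
- apply/seteqP; split => [w [h1 h2] i _|w h].
    by split; case: ifPn => // ij; [exact: h1|exact: h2].
  split => i ij.
    have : i \in undup (J1 ++ J2) by rewrite mem_undup mem_cat (ij : i \in J1).
    by move=> /h [+ _]; rewrite (ij : i \in J1).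
  have : i \in undup (J1 ++ J2) by rewrite mem_undup mem_cat (ij : i \in J2) orbT.
  by move=> /h [_ +]; rewrite (ij : i \in J2).
Qed.

Lemma cylinders_off_measurable : cylinders_off X p `<=` measurable.
Proof.
move=> _ [J [B [uJ _ mB ->]]]; apply: fin_bigcap_measurable => // i iJ.
by rewrite -[X in measurable X]setTI; apply: mX => //; exact: mB.
Qed.

Lemma sigma_off_measurable : <<s cylinders_off X p>> `<=` measurable.
Proof.
apply: smallest_sub; first exact: sigma_algebra_measurable.
exact: cylinders_off_measurable.
Qed.

Lemma measurable_fun_off d' (T' : measurableType d') (f : T -> T') :
  measurable_fun [set: G] (f : G -> T') -> measurable_fun [set: T] f.
Proof.
by move=> mf _ A mA; apply: sigma_off_measurable; exact: mf.
Qed.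

(** As functions of [E] both sides are finite measures, a restriction of [P] and a multiple of [P].
    They agree on cylinders, which are stable under intersection and generate the sigma-algebra. *)
Lemma independent_off (E : set T) (A : set R) : <<s cylinders_off X p>> E ->
  measurable A -> P (E `&` X p @^-1` A) = (P E * N A)%E.
Proof.
move=> GE mA.
have mXA : measurable (X p @^-1` A).
  by rewrite -[X in measurable X]setTI; exact: mX.
have fN : N A \is a fin_num by exact: fin_num_measure.
pose r : {nonneg R} := NngNum (fine_ge0 (measure_ge0 N A)).
have rE B : mscale r P B = (P B * N A)%E.
  by rewrite /mscale [r%:num]/(fine (N A)) fineK// muleC.
rewrite -rE -[LHS]/(mrestr P mXA E).
apply: (@g_sigma_algebra_measure_unique _ R T (cylinders_off X p)
  cylinders_off_measurable (fun=> setT) _ _ (mrestr P mXA) (mscale r P)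
  setI_closed_cylinders_off _ _ E GE).
- move=> _; exists [::], (fun=> setT); split => //.
  by apply/seteqP; split.
- by apply/seteqP; split => // w _; exists 0%N.
- move=> _ [J [B [uJ pJ mB ->]]]; apply: etrans (esym (rE _)).
  pose B' i := if i == p then A else B i.
  have B'E i : i \in J -> B' i = B i.
    by move=> iJ; rewrite /B'; case: eqP => // ip; move: pJ; rewrite -ip iJ.
  rewrite -[LHS]/(P ((\bigcap_(i in [set` J]) X i @^-1` B i) `&` X p @^-1` A)).
  have -> : (\bigcap_(i in [set` J]) X i @^-1` B i) `&` X p @^-1` A =
      \bigcap_(i in [set` p :: J]) X i @^-1` B' i.
    apply/seteqP; split => [w [h1 h2] i|w h].
      by rewrite /= inE /B'; case: eqP => [-> _//|_ /= iJ]; exact: h1.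
    split => [i iJ|]; last by have := h p; rewrite /= inE eqxx /B' eqxx; exact.
    by have := h i; rewrite /= inE (iJ : i \in J) orbT B'E//; exact.
  rewrite iX /= ?pJ//; last first.
    by move=> i; rewrite /B'; case: eqP => // /eqP ip; rewrite inE (negbTE ip) => /mB.
  rewrite big_cons {1}/B' eqxx gX// muleC iX//; congr (_ * _)%E.
  by apply: eq_big_seq => i iJ; rewrite B'E.
- by move=> k; rewrite ltey_eq fin_num_measure//; apply: measurableI.
Qed.

Lemma measurable_id_off : measurable_fun [set: T] (fun w : T => (w : G)).
Proof. by apply: measurable_fun_off; exact: measurable_id. Qed.

(** The identity as a random variable with values in the coarser space [G]: its law is [P]
    restricted to that sigma-algebra, and the joint law of [idG] and [X p] is a product measure. *)
Let idG : {mfun T >-> G} :=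
  HB.pack (fun w : T => (w : G)) (isMeasurableFun.Build _ _ _ _ _ measurable_id_off).

Lemma measurable_joint_off : measurable_fun [set: T] (fun w : T => (w : G, X p w : RR)).
Proof. by apply: measurable_fun_pair; [exact: measurable_id_off|exact: mX]. Qed.

Let jG : {mfun T >-> (G * RR)%type} :=
  HB.pack (fun w : T => (w : G, X p w : RR)) (isMeasurableFun.Build _ _ _ _ _ measurable_joint_off).

Let PG : probability G R := distribution P idG.
Let PJ : probability (G * RR)%type R := distribution P jG.

Let joint_law (A : set (G * RR)) : measurable A -> (PG \x N)%E A = PJ A.
Proof.
move=> mA; rewrite -(@product_measure_unique _ _ _ _ _ PG N PJ)// => E B mE mB.
exact: independent_off.
Qed.

(** Substitute for conditioning on all coordinates but [p]: under the product law, Tonelli's theorem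
    integrates out [X p] while [w] stays frozen. *)
Lemma freeze_ge0 (f : G * RR -> \bar R) : measurable_fun setT f ->
  (forall x, 0 <= f x)%E ->
  (\int[P]_w f (w : G, X p w : RR) = \int[P]_w \int[N]_z f (w : G, z))%E.
Proof.
move=> mf f0.
transitivity (\int[PJ]_x f x)%E; first by rewrite ge0_integral_distribution.
transitivity (\int[PG \x N]_x f x)%E.
  by apply: eq_measure_integral => A mA _; exact/esym/joint_law.
rewrite fubini_tonelli1// ge0_integral_distribution//.
- exact: (measurable_fun_fubini_tonelli_F f mf f0).
- by move=> w; apply: integral_ge0 => z _.
Qed.

Lemma freeze (f : G * RR -> R) : measurable_fun setT f ->
  P.-integrable setT (EFin \o (fun w => f (w : G, X p w : RR))) ->
  P.-integrable setT (fun w => \int[N]_z (f (w : G, z))%:E)%E /\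
  (\int[P]_w (f (w : G, X p w : RR))%:E = \int[P]_w \int[N]_z (f (w : G, z))%:E)%E.
Proof.
move=> mf intf.
have mEf : measurable_fun setT (EFin \o f) by exact/measurable_EFinP.
have intprod : (PG \x N)%E.-integrable setT (EFin \o f).
  apply/integrableP; split => //.
  have /integrableP[_] := intf; congr (_ < _)%E.
  transitivity (\int[PJ]_x `|(EFin \o f) x|)%E.
    by rewrite ge0_integral_distribution//; exact: measurableT_comp.
  by apply: eq_measure_integral => A mA _; exact/esym/joint_law.
have intF := integrable_fubini_F intprod.
have mF : measurable_fun [set: G] (fun w : G => \int[N]_z (f (w, z))%:E)%E.
  by case/integrableP : intF.
have intFP : P.-integrable setT (fun w => \int[N]_z (f (w : G, z))%:E)%E.
  apply/integrableP; split; first exact: measurable_fun_off.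
  have /integrableP[_] := intF; congr (_ < _)%E.
  by rewrite ge0_integral_distribution//; exact: measurableT_comp.
split=> //.
transitivity (\int[PJ]_x (f x)%:E)%E.
  by rewrite (integral_distribution (X := jG)).
transitivity (\int[PG \x N]_x (f x)%:E)%E.
  by apply: eq_measure_integral => A mA _; exact/esym/joint_law.
by rewrite -integral12_prod_meas1// (integral_distribution (X := idG)).
Qed.

Lemma freeze_mul_ge0 (Y : T -> R) (q : R -> R) :
  measurable_fun [set: G] (Y : G -> R) -> (forall w, 0 <= Y w) ->
  measurable_fun setT q -> (forall z, 0 <= q z) ->
  (\int[P]_w (Y w * q (X p w))%:E = \int[P]_w (Y w)%:E * \int[N]_z (q z)%:E)%E.
Proof.
move=> mY Y0 mq q0.
rewrite (@freeze_ge0 (fun x => (Y x.1 * q x.2)%:E)).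
- transitivity (\int[P]_w ((Y w)%:E * \int[N]_z (q z)%:E))%E.
    apply: eq_integral => w _; rewrite -ge0_integralZl//.
    - exact/measurable_EFinP.
    - by move=> z _; rewrite lee_fin.
    - by rewrite lee_fin.
  rewrite ge0_integralZr//.
  + by apply/measurable_EFinP; exact: measurable_fun_off.
  + by move=> w _; rewrite lee_fin.
  + by apply: integral_ge0 => z _; rewrite lee_fin.
- apply/measurable_EFinP/measurable_funM; exact: measurableT_comp.
- by move=> x; rewrite lee_fin mulr_ge0.
Qed.

(** For each frozen [w], [stein_lipschitz] applies to [F (w, _)] with the shift [a w]; averaging
    over [w] turns its bound into the second moment of [a]. Only the upper half of the estimate is
    kept. *)
Lemma stein_freeze (F : G * RR -> R) (a : T -> R) (L : R) :
  measurable_fun setT F -> measurable_fun [set: G] (a : G -> R) -> 0 <= L ->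
  (forall w z z', `|F (w, z) - F (w, z')| <= L * `|z - z'|) ->
  P.-integrable setT (EFin \o (fun w => a w ^+ 2)) ->
  P.-integrable setT (EFin \o (fun w => F (w : G, X p w : RR) - F (w : G, X p w - a w)
     - a w * (F (w : G, X p w : RR) * X p w))) ->
  \int[P]_w (F (w : G, X p w : RR) - F (w : G, X p w - a w)
     - a w * (F (w : G, X p w : RR) * X p w)) <=
  stein_cst * L * \int[P]_w (a w ^+ 2).
Proof.
move=> mF ma L0 FL ia2 iF.
pose f (x : G * RR) := F (x.1, x.2) - F (x.1, x.2 - a x.1) - a x.1 * (F (x.1, x.2) * x.2).
have ma1 : measurable_fun setT (fun x : G * RR => a x.1) by exact: measurableT_comp.
have mf : measurable_fun setT f.
  apply: measurable_funB; first apply: measurable_funB.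
  - by under eq_fun => x do rewrite -surjective_pairing.
  - apply: measurableT_comp => //; apply: measurable_fun_pair => //.
    exact: measurable_funB.
  - apply: measurable_funM => //; apply: measurable_funM => //.
    by under eq_fun => x do rewrite -surjective_pairing.
have [intf Ef] := freeze mf iF.
rewrite -RintegralZl//.
rewrite /Rintegral Ef; apply: fine_le.
- exact: integrable_fin_num.
- by apply: integrable_fin_num => //; exact: (integrableZl measurableT (stein_cst * L) ia2).
- apply: le_integral => //.
  + exact: (integrableZl measurableT (stein_cst * L) ia2).
  move=> w _.
  have mk : measurable_fun setT (fun z => F (w : G, z)) by exact: measurableT_comp.
  have := stein_lipschitz (a w) mk L0 (FL w).
  rewrite ler_norml => /andP[_].
  rewrite -lee_fin /Rintegral fineK//; apply: integrable_fin_num => //.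
  exact: (stein_integrable (a w) mk L0 (FL w)).
Qed.

End freezing.

(** * Euclidean geometry and smooth convex functions *)

Section euclidean.
Context {R : realType} {d : nat}.
Implicit Types x y z : 'rV[R]_d.

Definition dot x y : R := \sum_(i < d) x ord0 i * y ord0 i.

Lemma enorm_ge0 x : 0 <= enorm x.
Proof. exact: sqrtr_ge0. Qed.

Lemma enorm_sqr x : enorm x ^+ 2 = \sum_(i < d) x ord0 i ^+ 2.
Proof. by rewrite sqr_sqrtr// sumr_ge0// => i _; exact: sqr_ge0. Qed.

Lemma dotxx x : dot x x = enorm x ^+ 2.
Proof. by rewrite enorm_sqr; apply: eq_bigr => i _; rewrite expr2. Qed.

Lemma dotC x y : dot x y = dot y x.
Proof. by apply: eq_bigr => i _; rewrite mulrC. Qed.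

Lemma dotDl x y z : dot (x + y) z = dot x z + dot y z.
Proof. by rewrite -big_split; apply: eq_bigr => i _; rewrite mxE mulrDl. Qed.

Lemma dotZl a x y : dot (a *: x) y = a * dot x y.
Proof. by rewrite mulr_sumr; apply: eq_bigr => i _; rewrite mxE mulrA. Qed.

Lemma dotDr x y z : dot x (y + z) = dot x y + dot x z.
Proof. by rewrite dotC dotDl !(dotC x). Qed.

Lemma dotZr a x y : dot x (a *: y) = a * dot x y.
Proof. by rewrite dotC dotZl dotC. Qed.

Lemma dotBl x y z : dot (x - y) z = dot x z - dot y z.
Proof. by rewrite -scaleN1r dotDl dotZl mulN1r. Qed.

Lemma enormZ_sqr a x : enorm (a *: x) ^+ 2 = a ^+ 2 * enorm x ^+ 2.
Proof. by rewrite -!dotxx dotZl dotZr; ring. Qed.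

Lemma enormZ a x : enorm (a *: x) = `|a| * enorm x.
Proof.
apply/eqP; rewrite -(@eqrXn2 _ 2)// ?mulr_ge0 ?enorm_ge0//.
by rewrite enormZ_sqr exprMn real_normK ?num_real.
Qed.

Lemma enormN x : enorm (- x) = enorm x.
Proof. by rewrite -scaleN1r enormZ normrN normr1 mul1r. Qed.

Lemma enormB_sqr x y :
  enorm (x - y) ^+ 2 = enorm x ^+ 2 - 2 * dot x y + enorm y ^+ 2.
Proof.
rewrite -!dotxx -scaleN1r dotDl !dotDr !dotZl !dotZr (dotC y x); ring.
Qed.

Lemma enormD_sqr_le x y : enorm (x + y) ^+ 2 <= 2 * enorm x ^+ 2 + 2 * enorm y ^+ 2.
Proof.
have := sqr_ge0 (enorm (x - y)); rewrite enormB_sqr.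
have -> : enorm (x + y) ^+ 2 = enorm x ^+ 2 + 2 * dot x y + enorm y ^+ 2.
  by rewrite -!dotxx dotDl !dotDr (dotC y x); ring.
lra.
Qed.

(** Cauchy-Schwarz from |s x - y|^2 >= 0 at s = |y| / |x|; when one norm is 0, another [s]
    contradicts a positive inner product. *)
Lemma dot_le x y : dot x y <= enorm x * enorm y.
Proof.
have h s : 2 * s * dot x y <= s ^+ 2 * enorm x ^+ 2 + enorm y ^+ 2.
  have := sqr_ge0 (enorm (s *: x - y)).
  by rewrite enormB_sqr enormZ_sqr dotZl; lra.
have := enorm_ge0 x; rewrite le_eqVlt => /predU1P[x0|x0].
  rewrite -x0 mul0r leNgt; apply/negP => xy.
  have := h ((enorm y ^+ 2 + 1) / (2 * dot x y)).
  rewrite -x0 (_ : 2 * ((enorm y ^+ 2 + 1) / (2 * dot x y)) * dot x y = enorm y ^+ 2 + 1).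
    by rewrite expr0n/= mulr0; lra.
  by field; exact: lt0r_neq0.
have := h (enorm y / enorm x).
have -> : (enorm y / enorm x) ^+ 2 * enorm x ^+ 2 = enorm y ^+ 2.
  by field; exact: lt0r_neq0.
have -> : 2 * (enorm y / enorm x) * dot x y = 2 * (enorm y * dot x y) / enorm x.
  by field; exact: lt0r_neq0.
rewrite ler_pdivrMr// => h1.
have [y0|y0] := ltP 0 (enorm y).
  have h2 : enorm y * dot x y <= enorm y * (enorm x * enorm y).
    by apply: le_trans (_ : enorm y ^+ 2 * enorm x <= _); [lra|rewrite le_eqVlt; apply/orP; left; apply/eqP; ring].
  by rewrite -(ler_pM2l y0).
have y00 : enorm y = 0 by apply/eqP; rewrite eq_le y0 enorm_ge0.
rewrite y00 mulr0.
have := h (1 / (enorm x ^+ 2)); rewrite y00 expr0n/= addr0.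
move=> h3; rewrite leNgt; apply/negP => xy.
have := h (dot x y / enorm x ^+ 2); rewrite y00 expr0n/= addr0.
have -> : 2 * (dot x y / enorm x ^+ 2) * dot x y = 2 * (dot x y ^+ 2 / enorm x ^+ 2).
  by ring.
have -> : (dot x y / enorm x ^+ 2) ^+ 2 * enorm x ^+ 2 = dot x y ^+ 2 / enorm x ^+ 2.
  by field; exact: lt0r_neq0.
have : 0 < dot x y ^+ 2 / enorm x ^+ 2 by rewrite divr_gt0// exprn_gt0.
lra.
Qed.

Lemma dot_sqr_le x y : dot x y ^+ 2 <= enorm x ^+ 2 * enorm y ^+ 2.
Proof.
rewrite -exprMn -(real_normK (num_real (dot x y))) ler_sqr ?nnegrE ?mulr_ge0 ?enorm_ge0//.
rewrite ler_norml dot_le andbT.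
have := dot_le (- x) y; rewrite enormN -scaleN1r dotZl; lra.
Qed.

Lemma enorm_le_sum x : enorm x <= \sum_(i < d) `|x ord0 i|.
Proof.
have s0 : 0 <= \sum_(i < d) `|x ord0 i| by rewrite sumr_ge0.
rewrite -(@ler_sqr _ _ _) ?nnegrE ?enorm_ge0// enorm_sqr.
rewrite [leRHS]expr2 mulr_suml ler_sum// => i _.
rewrite -(real_normK (num_real _)) expr2 ler_wpM2l//.
by rewrite (bigD1 i)//= lerDl sumr_ge0.
Qed.

(** Neighbourhoods are sup-norm balls, on which the Euclidean norm is at most [d] times the radius;
    the [+ 1] keeps the denominator positive when [L * d%:R] vanishes. *)
Lemma lipschitz_const_continuous (L : R) (f : 'rV[R]_d -> R) : 0 <= L ->
  lipschitz_const L f -> continuous f.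
Proof.
move=> L0 fL x A /nbhs_ballP[e /= e0 eA]; apply/nbhs_ballP.
have K0 : 0 < L * d%:R + 1 by rewrite ltr_wpDl// mulr_ge0.
exists (e / (L * d%:R + 1)) => /=; first exact: divr_gt0.
move=> y [_ xy]; apply: eA; rewrite /ball/=.
apply: (le_lt_trans (fL _ _)).
apply: (@le_lt_trans _ _ (L * (d%:R * (e / (L * d%:R + 1))))).
  rewrite ler_wpM2l// (le_trans (enorm_le_sum _))//.
  apply: (@le_trans _ _ (\sum_(i < d) e / (L * d%:R + 1))).
    by apply: ler_sum => i _; rewrite !mxE ltW//; exact: xy.
  by rewrite sumr_const card_ord mulr_natl.
have -> : L * (d%:R * (e / (L * d%:R + 1))) = (L * d%:R * e) / (L * d%:R + 1) by ring.
rewrite ltr_pdivrMr// mulrC ltr_pM2l//; lra.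
Qed.

Lemma convex_fun_le (f : 'rV[R]_d -> R) (s : R) x y : convex_fun f -> 0 <= s -> s <= 1 ->
  f ((1 - s) *: x + s *: y) <= (1 - s) * f x + s * f y.
Proof.
move=> cf s0 s1; have := cf (Itv01 s0 s1) y x (in_setT _) (in_setT _).
by rewrite (addrC (_ *: x)) (addrC (_ * f x)).
Qed.

End euclidean.

Section smooth_convex.
Context {R : realType} {d : nat}.
Implicit Types x y h : 'rV[R]_d.
Variable f : 'rV[R]_d -> R.

Lemma derive_dot_gradient x h : differentiable f x -> 'D_h f x = dot (gradient f x) h.
Proof.
move=> df; rewrite deriveE// {1}(row_sum_delta h) linear_sum; apply: eq_bigr => i _.
by rewrite linearZ /= mxE deriveE// mulrC.
Qed.

Lemma is_derive_line x h (t : R) : (forall y, differentiable f y) ->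
  is_derive t (1 : R) (fun s : R => f (x + s *: h)) (dot (gradient f (x + t *: h)) h).
Proof.
move=> df; rewrite -derive_dot_gradient//.
pose phi (s : R) : R := f (x + s *: h).
have E : (fun k : R => k^-1 *: ((phi \o shift t) (k *: (1 : R)) - phi t)) =
    (fun k : R => k^-1 *: ((f \o shift (x + t *: h)) (k *: h) - f (x + t *: h))).
  apply/funext => k; congr (_ *: (_ - _)); rewrite /phi /=; congr f.
  by rewrite scalerDl /GRing.scale /= mulr1 addrCA.
apply: DeriveDef; last by rewrite /derive E.
by rewrite /derivable E; exact: diff_derivable.
Qed.

Variable L : R.
Hypothesis fL : lipschitz_gradient_const L f.
Hypothesis L0 : 0 <= L.

(** Along the segment, [psi] is [f] minus the terms of the claimed bound that vary with [s].
    Cauchy-Schwarz and the Lipschitz gradient make its derivative nonpositive, so [psi 1 <= psi 0]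
    and no gradient has to be integrated. *)
Lemma descent x h : f (x + h) <= f x + dot (gradient f x) h + L / 2 * enorm h ^+ 2.
Proof.
have [df gL] := fL.
pose phi (s : R) : R := f (x + s *: h).
pose psi (s : R) : R := phi s - (s * dot (gradient f x) h + L / 2 * enorm h ^+ 2 * s ^+ 2).
have dphi (t : R) := is_derive_line x h t df.
have dpsi (t : R) : is_derive t (1 : R) psi (dot (gradient f (x + t *: h)) h -
    (dot (gradient f x) h + L * enorm h ^+ 2 * t)).
  apply: is_deriveB.
  apply: is_derive_eq.
  by rewrite /GRing.scale /=; field.
have psi_le (t : R) : 0 <= t -> dot (gradient f (x + t *: h)) h -
    (dot (gradient f x) h + L * enorm h ^+ 2 * t) <= 0.
  move=> t0; have := dot_le (gradient f (x + t *: h) - gradient f x) h.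
  rewrite dotBl.
  have : enorm (gradient f (x + t *: h) - gradient f x) * enorm h <=
      L * (t * enorm h) * enorm h.
    rewrite ler_wpM2r ?enorm_ge0// (le_trans (gL _ _))// ler_wpM2l//.
    by rewrite addrC addKr enormZ ger0_norm.
  lra.
have : psi 1 <= psi 0.
  apply: (@ler0_derive1_nincr _ psi 0 1) => //.
  - by move=> t /=; rewrite in_itv /= => /andP[/ltW t0 _]; rewrite derive1E (derive_val (is_derive := dpsi t)) psi_le.
  - apply: continuous_subspaceT => t; apply: differentiable_continuous.
    by apply/derivable1_diffP; exact: ex_derive.
rewrite /psi /phi !scale0r scale1r addr0 !expr1n mul0r expr0n/= mulr0 addr0 subr0; lra.
Qed.

(** Convexity bounds f(x + s h) from above. The descent lemma from x + s h back to x bounds it from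
    below, up to L s^2 |h|^2 / 2, and moving the gradient from x + s h to x costs another L s^2
    |h|^2: together the [3 * L / 2] removed by [ler_eps_sqr]. *)
Lemma gradient_le x h : convex_fun f -> f x + dot (gradient f x) h <= f (x + h).
Proof.
have [df gL] := fL; move=> cf.
suff : dot (gradient f x) h <= f (x + h) - f x by lra.
apply: (@ler_eps_sqr _ _ _ (3 * L / 2 * enorm h ^+ 2)) => s s0 s1.
have := convex_fun_le x (x + h) cf (ltW s0) s1.
have -> : (1 - s) *: x + s *: (x + h) = x + s *: h.
  by rewrite scalerDr addrA -scalerDl subrK scale1r.
have := descent (x + s *: h) (- (s *: h)).
rewrite addrK enormN enormZ_sqr -scaleNr dotZr.
have := dot_le (gradient f x - gradient f (x + s *: h)) h.
rewrite dotBl.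
have : enorm (gradient f x - gradient f (x + s *: h)) * enorm h <= L * (s * enorm h) * enorm h.
  rewrite ler_wpM2r ?enorm_ge0// (le_trans (gL _ _))// ler_wpM2l//.
  by rewrite opprD addrA subrr add0r enormN enormZ gtr0_norm.
set a := _ * enorm h; set e := enorm h.
set b := dot (gradient f (x + s *: h)) h; set c := dot (gradient f x) h.
move=> h1 h2 h3 h4.
have : s * (c - b) <= s * (L * (s * e) * e) by rewrite ler_wpM2l ?(ltW s0)//; lra.
lra.
Qed.

(** By [descent], one gradient step of length 1 / L lowers [f] by at least |grad f|^2 / (2 L). *)
Lemma gradient_sqr_le x : 0 < L -> enorm (gradient f x) ^+ 2 <= 2 * L * (f x - f (x - L^-1 *: gradient f x)).
Proof.
move=> L1; have := descent x (- (L^-1 *: gradient f x)).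
rewrite enormN enormZ_sqr -scaleNr dotZr dotxx.
set e := enorm _ ^+ 2; move=> h1.
have : 2 * L * (f (x + - L^-1 *: gradient f x) - f x + e / (2 * L)) <= 2 * L * 0.
  rewrite ler_wpM2l//; first lra.
  have : - L^-1 * e + L / 2 * ((L^-1) ^+ 2 * e) = - (e / (2 * L)) by field; exact: lt0r_neq0.
  lra.
have -> : 2 * L * (f (x + - L^-1 *: gradient f x) - f x + e / (2 * L)) =
   2 * L * (f (x + - L^-1 *: gradient f x) - f x) + e by field; exact: lt0r_neq0.
lra.
Qed.

Lemma gradient_minimizer_sqr_le x xs : 0 < L -> global_minimizer f xs ->
  enorm (gradient f x) ^+ 2 <= 2 * L * (f x - f xs).
Proof.
move=> L1 ms; apply: (le_trans (gradient_sqr_le x L1)).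
by rewrite ler_wpM2l ?mulr_ge0// lerB// ms.
Qed.

Lemma gradient_minimizer0 xs : 0 < L -> global_minimizer f xs -> enorm (gradient f xs) = 0.
Proof.
move=> L1 ms; apply/eqP; rewrite -sqrf_eq0 eq_le sqr_ge0 andbT.
by have := gradient_minimizer_sqr_le xs L1 ms; rewrite subrr mulr0.
Qed.

Lemma continuous_gradient (i : 'I_d) : continuous (fun x => gradient f x ord0 i).
Proof.
apply: (@lipschitz_const_continuous _ _ L) => // x y.
have [_ gL] := fL; apply: le_trans (gL x y).
have -> : gradient f x ord0 i - gradient f y ord0 i = (gradient f x - gradient f y) ord0 i.
  by rewrite !mxE.
rewrite -(@ler_sqr _ _ _) ?nnegrE ?enorm_ge0// enorm_sqr real_normK ?num_real//.
by rewrite (bigD1 i)//= lerDl sumr_ge0// => j _; exact: sqr_ge0.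
Qed.

End smooth_convex.

(** * The residual-feedback process *)

Section expectation_calculus.
Context d (T : measurableType d) {R : realType} (P : probability T R).
Implicit Types X Y Z : T -> R.
Local Notation Int X := (P.-integrable setT (EFin \o X)).
Local Notation E X := (Rintegral P setT X).

Lemma IntD X Y : Int X -> Int Y -> Int (fun w => X w + Y w).
Proof. by move=> iX iY; exact: (integrableD measurableT iX iY). Qed.

Lemma IntB X Y : Int X -> Int Y -> Int (fun w => X w - Y w).
Proof. by move=> iX iY; exact: (integrableB measurableT iX iY). Qed.

Lemma IntZ a X : Int X -> Int (fun w => a * X w).
Proof. by move=> iX; exact: (integrableZl measurableT a iX). Qed.

Lemma Int_cst a : Int (fun=> a).
Proof. exact: finite_measure_integrable_cst. Qed.

Lemma Int_sum (I : Type) (s : seq I) (F : I -> T -> R) :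
  (forall i, Int (F i)) -> Int (fun w => \sum_(i <- s) F i w).
Proof.
move=> iF; elim: s => [|i s IH].
  by under eq_fun do rewrite big_nil; exact: Int_cst.
by under eq_fun do rewrite big_cons; exact: IntD.
Qed.

Lemma Int_measurable X : Int X -> measurable_fun setT X.
Proof. by case/integrableP => /measurable_EFinP. Qed.

Lemma Int_dom X Y : measurable_fun setT X -> Int Y ->
  (forall w, `|X w| <= Y w) -> Int X.
Proof.
move=> mX iY XY; apply: (le_integrable measurableT _ _ iY).
  exact/measurable_EFinP.
by move=> w _ /=; rewrite lee_fin (le_trans (XY w))// ler_norm.
Qed.

Lemma EZ a X : Int X -> E (fun w => a * X w) = a * E X.
Proof. by move=> iX; rewrite -RintegralZl. Qed.

Lemma ED X Y : Int X -> Int Y -> E (fun w => X w + Y w) = E X + E Y.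
Proof. by move=> iX iY; rewrite -RintegralD. Qed.

Lemma EB X Y : Int X -> Int Y -> E (fun w => X w - Y w) = E X - E Y.
Proof. by move=> iX iY; rewrite -RintegralB. Qed.

Lemma E_cst a : E (fun=> a) = a.
Proof.
transitivity (a * fine (1%E : \bar R)); last by rewrite mulr1.
by rewrite Rintegral_cst//; congr (_ * fine _); exact: (probability_setT P).
Qed.

Lemma E_le X Y : Int X -> Int Y -> (forall w, X w <= Y w) -> E X <= E Y.
Proof. by move=> iX iY XY; apply: le_Rintegral. Qed.

Lemma E_ge0 X : (forall w, 0 <= X w) -> 0 <= E X.
Proof. by move=> X0; apply: Rintegral_ge0. Qed.

Lemma E_sum (I : Type) (s : seq I) (F : I -> T -> R) :
  (forall i, Int (F i)) -> E (fun w => \sum_(i <- s) F i w) = \sum_(i <- s) E (F i).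
Proof.
move=> iF; elim: s => [|i s IH].
  by under eq_fun do rewrite big_nil; rewrite E_cst big_nil.
by under eq_fun do rewrite big_cons; rewrite ED ?IH ?big_cons//; exact: Int_sum.
Qed.

Definition L2 X := measurable_fun setT X /\ Int (fun w => X w ^+ 2).

Lemma L2_cst a : L2 (fun=> a).
Proof. by split=> //; exact: Int_cst. Qed.

Lemma L2_mul X Y : L2 X -> L2 Y -> Int (fun w => X w * Y w).
Proof.
move=> [mX iX] [mY iY]; apply: (Int_dom _ (IntD iX iY)).
  exact: measurable_funM.
move=> w; rewrite ler_norml; have := sqr_ge0 (X w + Y w); have := sqr_ge0 (X w - Y w).
have := sqr_ge0 (X w); have := sqr_ge0 (Y w).
move=> *; apply/andP; split; lra.
Qed.

Lemma L2D X Y : L2 X -> L2 Y -> L2 (fun w => X w + Y w).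
Proof.
move=> [mX iX] [mY iY]; split; first exact: measurable_funD.
have iXY := IntD (IntZ 2 iX) (IntZ 2 iY).
apply: (Int_dom _ iXY) => [|w].
  by apply: measurable_funX; exact: measurable_funD.
rewrite ger0_norm ?sqr_ge0//; have := sqr_ge0 (X w - Y w).
lra.
Qed.

Lemma L2Z a X : L2 X -> L2 (fun w => a * X w).
Proof.
move=> [mX iX]; split; first exact: measurable_funM.
by under eq_fun do rewrite exprMn; exact: IntZ.
Qed.

Lemma L2B X Y : L2 X -> L2 Y -> L2 (fun w => X w - Y w).
Proof.
move=> lX lY; have := L2D lX (L2Z (-1) lY).
by under eq_fun do rewrite mulN1r.
Qed.

End expectation_calculus.

Section run_measurability.
Context {R : realType} (n : nat).
Variables (f : 'rV[R]_n -> R) (eta delta : R) (x0 : 'rV[R]_n).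
Hypothesis cf : continuous f.

Definition query (Omega : Type) (u x : nat -> Omega -> 'rV[R]_n) t w : 'rV[R]_n :=
  x t w + delta *: u t w.

(** The default [0] at time 0 lets the single formula [run_gE] cover both cases of the estimate. *)
Definition residual (Omega : Type) (u x : nat -> Omega -> 'rV[R]_n) t w : R :=
  if t is s.+1 then f (query u x s w) else 0.

Lemma run_gE (Omega : Type) (u x g : nat -> Omega -> 'rV[R]_n) t w :
  residual_feedback_run f eta delta x0 u x g ->
  g t w = ((f (query u x t w) - residual u x t w) / delta) *: u t w.
Proof.
by case=> _ g0 gS _; case: t => [|t]; [rewrite g0 /= subr0|rewrite gS].
Qed.

(** Only the noise before time [t] is assumed measurable, and [S] is arbitrary. With [S] the space
    omitting a coordinate of [u t], this expresses that [x t] and the baseline at time [t] do not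
    depend on that coordinate. *)
Lemma run_measurable d (S : measurableType d) (u x g : nat -> S -> 'rV[R]_n) (t : nat) :
  residual_feedback_run f eta delta x0 u x g ->
  (forall s i, (s < t)%N -> measurable_fun setT (fun w => u s w ord0 i)) ->
  forall s, (s <= t)%N ->
  (forall i, measurable_fun setT (fun w => x s w ord0 i)) /\
  measurable_fun setT (residual u x s).
Proof.
move=> run mu; elim=> [_|s IH st].
  split=> [i|]; last exact: measurable_cst.
  by under eq_fun do rewrite (rf_x0 run); exact: measurable_cst.
have [mx mr] := IH (ltnW st).
have mq : measurable_fun setT (fun w => f (query u x s w)).
  apply: (measurable_fun_continuous_rV _ cf) => i.
  under eq_fun do rewrite !mxE.
  by apply: measurable_funD => //; apply: measurable_funM => //; exact: mu.
split=> // i; under eq_fun do rewrite (rf_xS run) (run_gE _ _ run) !mxE.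
apply: measurable_funB => //; apply: measurable_funM => //.
apply: measurable_funM; last exact: mu.
by apply: measurable_funM => //; exact: measurable_funB.
Qed.

End run_measurability.

Section power_means.
Context {R : realType} (d : nat).
Implicit Type a : 'I_d -> R.

(** Each square lies above its tangent at the mean [m], and the linear parts of the tangents sum to
    0. [sum_cube_le] uses the same argument for cubes. *)
Lemma sum_sqr_le a : (\sum_(i < d) a i) ^+ 2 <= d%:R * \sum_(i < d) a i ^+ 2.
Proof.
have [d0|d0] := posnP d; first by subst d; rewrite !big_ord0 expr0n/= mul0r.
have d0' : 0 < d%:R :> R by rewrite ltr0n.
set S := \sum_(i < d) a i; pose m := S / d%:R.
have : \sum_(i < d) (m ^+ 2 + 2 * m * (a i - m)) <= \sum_(i < d) a i ^+ 2.
  by apply: ler_sum => i _; have := sqr_ge0 (a i - m); lra.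
rewrite big_split/= sumr_const card_ord -mulr_sumr sumrB -/S sumr_const card_ord.
rewrite -(mulr_natl (m ^+ 2) d) -(mulr_natl m d) => h.
have := ler_wpM2l (ltW d0') h; apply: le_trans.
by rewrite le_eqVlt; apply/orP; left; apply/eqP; rewrite /m; field; exact: lt0r_neq0.
Qed.

Lemma sum_cube_le a : (forall i, 0 <= a i) ->
  (\sum_(i < d) a i) ^+ 3 <= d%:R ^+ 2 * \sum_(i < d) a i ^+ 3.
Proof.
move=> a0.
have [d0|d0] := posnP d; first by subst d; rewrite !big_ord0 expr0n/= mulr0.
have d0' : 0 < d%:R :> R by rewrite ltr0n.
set S := \sum_(i < d) a i; pose m := S / d%:R.
have m0 : 0 <= m by rewrite divr_ge0// sumr_ge0.
have : \sum_(i < d) (m ^+ 3 + 3 * m ^+ 2 * (a i - m)) <= \sum_(i < d) a i ^+ 3.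
  apply: ler_sum => i _.
  (* This product is exactly the cube of [a i] minus its tangent at [m]. *)
  have : 0 <= (a i - m) ^+ 2 * (a i + 2 * m).
    by rewrite mulr_ge0 ?sqr_ge0// addr_ge0// mulr_ge0.
  lra.
rewrite big_split/= sumr_const card_ord -mulr_sumr sumrB -/S sumr_const card_ord.
rewrite -(mulr_natl (m ^+ 3) d) -(mulr_natl m d) => h.
have := ler_wpM2l (sqr_ge0 d%:R) h; apply: le_trans.
by rewrite le_eqVlt; apply/orP; left; apply/eqP; rewrite /m; field; exact: lt0r_neq0.
Qed.

Lemma sqr_add3_le (a b c : R) : (a + b - c) ^+ 2 <= 3 * (a ^+ 2 + b ^+ 2 + c ^+ 2).
Proof.
have := sqr_ge0 (a - b); have := sqr_ge0 (b + c); have := sqr_ge0 (a + c); lra.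
Qed.

End power_means.

Section residual_process.
Context disp (T : measurableType disp) {R : realType} (P : probability T R) (d : nat).
Variables (u x g : nat -> T -> 'rV[R]_d) (f : 'rV[R]_d -> R).
Variables (eta delta L0 : R) (x0 xs : 'rV[R]_d).
Hypothesis delta_gt0 : 0 < delta.
Hypothesis L0_ge0 : 0 <= L0.
Hypothesis fL : lipschitz_const L0 f.
Hypothesis iid : iid_standard_gaussian P u.
Hypothesis run : residual_feedback_run f eta delta x0 u x g.
Local Notation N := (@normal_prob R 0 1).
Local Notation Int X := (P.-integrable setT (EFin \o X)).
Local Notation E X := (Rintegral P setT X).
Local Notation q := (query delta u x).
Local Notation res := (residual f delta u x).

Let U (p : nat * 'I_d) w := u p.1 w ord0 p.2.
Local Notation G p := (g_sigma_algebraType (cylinders_off U p)).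

Let cf : continuous f.
Proof. exact: (lipschitz_const_continuous L0_ge0 fL). Qed.

Let mU p : measurable_fun setT (U p).
Proof. by have [/(_ p.1)[+ _ _] _] := iid; exact: random_vector_coord. Qed.

Let iU : mutually_independent P [set A : set R | measurable A] U.
Proof. exact: iid_gaussian_coord_independent. Qed.

Let gU p A : measurable A -> P (U p @^-1` A) = N A.
Proof. by move=> mA; have [/(_ p.1)[_ + _] _] := iid; apply. Qed.

Lemma off_u p s j : (s, j) != p ->
  measurable_fun [set: G p] (fun w : G p => u s w ord0 j).
Proof. exact: (@measurable_coord_off _ _ _ _ U p (s, j)). Qed.

Lemma off_run t i s : (s <= t)%N ->
  (forall j, measurable_fun [set: G (t, i)] (fun w : G (t, i) => x s w ord0 j)) /\
  measurable_fun [set: G (t, i)] (res s : G (t, i) -> R).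
Proof.
apply: (run_measurable cf (S := G (t, i)) run) => r j rt.
by apply: off_u; apply/eqP => -[rt' _]; rewrite rt' ltnn in rt.
Qed.

Lemma off_mfun p (Y : T -> R) : measurable_fun [set: G p] (Y : G p -> R) ->
  measurable_fun [set: T] Y.
Proof. exact: (measurable_fun_off mU). Qed.

Lemma moment_mul p (Y : T -> R) (h : R -> R) : measurable_fun [set: G p] (Y : G p -> R) ->
  (forall w, 0 <= Y w) -> Int Y -> measurable_fun setT h -> (forall z, 0 <= h z) ->
  N.-integrable setT (EFin \o h) ->
  Int (fun w => Y w * h (U p w)) /\ E (fun w => Y w * h (U p w)) = E Y * \int[N]_z h z.
Proof.
move=> mY Y0 iY mh h0 ih.
have Ef := freeze_mul_ge0 mU iU (gU p) mY Y0 mh h0.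
have fY : (\int[P]_w (Y w)%:E)%E \is a fin_num := integrable_fin_num measurableT iY.
have fh : (\int[N]_z (h z)%:E)%E \is a fin_num := integrable_fin_num measurableT ih.
split; last by rewrite /Rintegral Ef fineM.
apply/integrableP; split.
  apply/measurable_EFinP/measurable_funM; first exact: off_mfun mY.
  exact: measurableT_comp.
under eq_integral do rewrite /= ger0_norm ?mulr_ge0//.
by rewrite Ef ltey_eq fin_numM.
Qed.

Lemma moment_mul2 p (Y : T -> R) : measurable_fun [set: G p] (Y : G p -> R) ->
  (forall w, 0 <= Y w) -> Int Y ->
  Int (fun w => Y w * U p w ^+ 2) /\ E (fun w => Y w * U p w ^+ 2) <= E Y.
Proof.
move=> mY Y0 iY.
have [||i e] := moment_mul mY Y0 iY _ _ (normal_integrable_expX 2).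
- exact: measurable_funX.
- by move=> z; exact: sqr_ge0.
split=> //; rewrite e ler_piMr ?E_ge0//; exact: normal_second_moment.
Qed.

Lemma moment_mul4 p (Y : T -> R) : measurable_fun [set: G p] (Y : G p -> R) ->
  (forall w, 0 <= Y w) -> Int Y ->
  Int (fun w => Y w * U p w ^+ 4) /\ E (fun w => Y w * U p w ^+ 4) <= 3 * E Y.
Proof.
move=> mY Y0 iY.
have [||i e] := moment_mul mY Y0 iY _ _ (normal_integrable_expX 4).
- exact: measurable_funX.
- by move=> z; rewrite exprn_even_ge0.
split=> //; rewrite e mulrC ler_wpM2r ?E_ge0//; exact: normal_fourth_moment.
Qed.

(* Left unevaluated: only its not depending on [d] matters. *)
Definition normal_m6 : R := \int[N]_z (z ^+ 6).

Lemma moment_mul6 p (Y : T -> R) : measurable_fun [set: G p] (Y : G p -> R) ->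
  (forall w, 0 <= Y w) -> Int Y ->
  Int (fun w => Y w * U p w ^+ 6) /\ E (fun w => Y w * U p w ^+ 6) = normal_m6 * E Y.
Proof.
move=> mY Y0 iY.
have [||i e] := moment_mul mY Y0 iY _ _ (normal_integrable_expX 6).
- exact: measurable_funX.
- by move=> z; rewrite exprn_even_ge0.
by split=> //; rewrite e mulrC.
Qed.

Lemma normal_m6_ge0 : 0 <= normal_m6.
Proof. by apply: Rintegral_ge0 => z _; rewrite exprn_even_ge0. Qed.

Section fixed_time.
Variable (t : nat) (Y : T -> R).
Hypothesis mY : forall i, measurable_fun [set: G (t, i)] (Y : G (t, i) -> R).
Hypothesis Y0 : forall w, 0 <= Y w.
Hypothesis iY : Int Y.
Hypothesis d_gt0 : (0 < d)%N.

Let sumE (k : nat) (m : R) :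
  (forall i, Int (fun w => Y w * U (t, i) w ^+ k) /\ E (fun w => Y w * U (t, i) w ^+ k) <= m * E Y) ->
  Int (fun w => Y w * \sum_(i < d) U (t, i) w ^+ k) /\
  E (fun w => Y w * \sum_(i < d) U (t, i) w ^+ k) <= d%:R * m * E Y.
Proof.
move=> h; under eq_fun do rewrite mulr_sumr; split.
  by apply: Int_sum => i; have [] := h i.
rewrite E_sum; last by move=> i; have [] := h i.
apply: (@le_trans _ _ (\sum_(i < d) m * E Y)).
  by apply: ler_sum => i _; have [] := h i.
by rewrite sumr_const card_ord -mulrA mulr_natl.
Qed.

Let mY' : measurable_fun setT Y.
Proof. exact: off_mfun (@mY (Ordinal d_gt0)). Qed.

Let mnu k : measurable_fun setT (fun w => enorm (u t w) ^+ (2 * k)).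
Proof.
under eq_fun do rewrite exprM enorm_sqr.
apply: measurable_funX; apply: measurable_sum => i; apply: measurable_funX.
exact: (mU (t, i)).
Qed.

Lemma moment_norm2 : Int (fun w => Y w * enorm (u t w) ^+ 2) /\
  E (fun w => Y w * enorm (u t w) ^+ 2) <= d%:R * E Y.
Proof.
have [i e] : Int (fun w => Y w * \sum_(i < d) U (t, i) w ^+ 2) /\
    E (fun w => Y w * \sum_(i < d) U (t, i) w ^+ 2) <= d%:R * 1 * E Y.
  by apply: sumE => i; rewrite mul1r; exact: moment_mul2.
rewrite mulr1 in e.
by under eq_fun do rewrite enorm_sqr.
Qed.

(** Freezing handles one coordinate at a time, so the mixed products in |u|^4 are removed by the
    power-mean inequality; the order d^2 is not lost. [moment_norm6] does the same with cubes. *)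
Lemma moment_norm4 : Int (fun w => Y w * enorm (u t w) ^+ 4) /\
  E (fun w => Y w * enorm (u t w) ^+ 4) <= 3 * d%:R ^+ 2 * E Y.
Proof.
have [i e] : Int (fun w => Y w * \sum_(i < d) U (t, i) w ^+ 4) /\
    E (fun w => Y w * \sum_(i < d) U (t, i) w ^+ 4) <= d%:R * 3 * E Y.
  by apply: sumE => i; exact: moment_mul4.
have le w : Y w * enorm (u t w) ^+ 4 <= d%:R * (Y w * \sum_(i < d) U (t, i) w ^+ 4).
  rewrite [leRHS]mulrCA ler_wpM2l// (exprM _ 2 2) enorm_sqr.
  apply: (le_trans (sum_sqr_le _)); rewrite ler_wpM2l//.
  by apply: ler_sum => j _; rewrite -exprM.
have i4 : Int (fun w => Y w * enorm (u t w) ^+ 4).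
  apply: (Int_dom _ (IntZ d%:R i)); first exact: measurable_funM mY' (mnu 2).
  by move=> w; rewrite ger0_norm// mulr_ge0// exprn_even_ge0.
split=> //; apply: (le_trans (E_le i4 (IntZ d%:R i) le)); rewrite EZ//.
have := ler_wpM2l (ler0n R d) e; lra.
Qed.

Lemma moment_norm6 : Int (fun w => Y w * enorm (u t w) ^+ 6) /\
  E (fun w => Y w * enorm (u t w) ^+ 6) <= normal_m6 * d%:R ^+ 3 * E Y.
Proof.
have [i e] : Int (fun w => Y w * \sum_(i < d) U (t, i) w ^+ 6) /\
    E (fun w => Y w * \sum_(i < d) U (t, i) w ^+ 6) <= d%:R * normal_m6 * E Y.
  by apply: sumE => i; have [? ->] := moment_mul6 (@mY i) Y0 iY.
have le w : Y w * enorm (u t w) ^+ 6 <= d%:R ^+ 2 * (Y w * \sum_(i < d) U (t, i) w ^+ 6).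
  rewrite [leRHS]mulrCA ler_wpM2l// (exprM _ 2 3) enorm_sqr.
  apply: (le_trans (sum_cube_le _)) => [j|]; first exact: sqr_ge0.
  by rewrite ler_wpM2l ?sqr_ge0//; apply: ler_sum => j _; rewrite -exprM.
have i6 : Int (fun w => Y w * enorm (u t w) ^+ 6).
  apply: (Int_dom _ (IntZ (d%:R ^+ 2) i)); first exact: measurable_funM mY' (mnu 3).
  by move=> w; rewrite ger0_norm// mulr_ge0// exprn_even_ge0.
split=> //; apply: (le_trans (E_le i6 (IntZ (d%:R ^+ 2) i) le)); rewrite EZ//.
have := ler_wpM2l (sqr_ge0 (d%:R : R)) e; lra.
Qed.

End fixed_time.

Hypothesis d_gt0 : (0 < d)%N.

Let cstm c p : measurable_fun [set: G p] ((fun=> c) : G p -> R).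
Proof. exact: measurable_cst. Qed.

Lemma off_norm2_u s p : (forall j, (s, j) != p) ->
  measurable_fun [set: G p] ((fun w => enorm (u s w) ^+ 2) : G p -> R).
Proof.
move=> sp; under eq_fun do rewrite enorm_sqr.
by apply: measurable_sum => j; apply: measurable_funX; exact: off_u.
Qed.

Lemma u_norm2 t : Int (fun w => enorm (u t w) ^+ 2) /\ E (fun w => enorm (u t w) ^+ 2) <= d%:R.
Proof.
have := moment_norm2 (t := t) (Y := fun=> 1) (fun i => @cstm 1 (t, i)) (fun=> ler01) (Int_cst P 1).
by rewrite E_cst mulr1; under eq_fun do rewrite mul1r.
Qed.

Lemma u_norm4 t : Int (fun w => enorm (u t w) ^+ 4) /\
  E (fun w => enorm (u t w) ^+ 4) <= 3 * d%:R ^+ 2.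
Proof.
have := moment_norm4 (t := t) (Y := fun=> 1) (fun i => @cstm 1 (t, i)) (fun=> ler01) (Int_cst P 1) d_gt0.
by rewrite E_cst mulr1; under eq_fun do rewrite mul1r.
Qed.

Lemma u_norm6 t : Int (fun w => enorm (u t w) ^+ 6) /\
  E (fun w => enorm (u t w) ^+ 6) <= normal_m6 * d%:R ^+ 3.
Proof.
have := moment_norm6 (t := t) (Y := fun=> 1) (fun i => @cstm 1 (t, i)) (fun=> ler01) (Int_cst P 1) d_gt0.
by rewrite E_cst mulr1; under eq_fun do rewrite mul1r.
Qed.

Let resid t w : R := f (q t w) - res t w.

Lemma g_norm2E t w : enorm (g t w) ^+ 2 = (resid t w / delta) ^+ 2 * enorm (u t w) ^+ 2.
Proof. by rewrite (run_gE _ _ run) enormZ_sqr. Qed.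

Let mx t : forall j, measurable_fun setT (fun w => x t w ord0 j).
Proof. by move=> j; have [mx _] := @off_run t (Ordinal d_gt0) t (leqnn t); exact: off_mfun (mx j). Qed.

Let mres t : measurable_fun setT (res t).
Proof. by have [_ mr] := @off_run t (Ordinal d_gt0) t (leqnn t); exact: off_mfun mr. Qed.

Let mq t : measurable_fun setT (fun w => f (q t w)).
Proof. exact: (mres t.+1). Qed.

Let mg t j : measurable_fun setT (fun w => g t w ord0 j).
Proof.
under eq_fun do rewrite (run_gE _ _ run) mxE.
apply: measurable_funM; last exact: (mU (t, j)).
by apply: measurable_funM => //; exact: measurable_funB.
Qed.

Let mnorm2 (X : T -> 'rV[R]_d) : (forall j, measurable_fun setT (fun w => X w ord0 j)) ->
  measurable_fun setT (fun w => enorm (X w) ^+ 2).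
Proof.
move=> mX; under eq_fun do rewrite enorm_sqr.
by apply: measurable_sum => j; exact: measurable_funX.
Qed.

Lemma off_g_norm2 t i :
  measurable_fun [set: G (t.+1, i)] ((fun w => enorm (g t w) ^+ 2) : G (t.+1, i) -> R).
Proof.
under eq_fun do rewrite g_norm2E.
apply: measurable_funM.
  apply: measurable_funX; apply: measurable_funM => //; apply: measurable_funB.
    by have [_] := @off_run t.+1 i _ (leqnn t.+1).
  by have [_] := @off_run t.+1 i _ (leqnSn t).
by apply: off_norm2_u => j; apply/eqP => -[/eqP]; rewrite ltn_eqF.
Qed.

Lemma g0_norm2_int : Int (fun w => enorm (g 0%N w) ^+ 2).
Proof.
have [i2 _] := u_norm2 0; have [i4 _] := u_norm4 0.
apply: (Int_dom _ (IntD (IntZ (2 * f x0 ^+ 2 / delta ^+ 2) i2) (IntZ (2 * L0 ^+ 2) i4))).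
  by apply: mnorm2; exact: mg.
move=> w; rewrite ger0_norm ?sqr_ge0// g_norm2E /resid /query /= subr0 (rf_x0 run).
have h := fL (x0 + delta *: u 0%N w) x0.
rewrite [x0 + _ - x0]addrAC subrr add0r enormZ (gtr0_norm delta_gt0) in h.
have h2 : (f (x0 + delta *: u 0%N w) - f x0) ^+ 2 <= (L0 * (delta * enorm (u 0%N w))) ^+ 2.
  rewrite -(real_normK (num_real (_ - _))) ler_sqr ?nnegrE//.
  by rewrite mulr_ge0 // mulr_ge0 ?enorm_ge0 // ltW.
set a := f (x0 + _) in h2 *; set b := f x0 in h2 *; set e := enorm _ in h2 *.
have h3 : a ^+ 2 <= 2 * b ^+ 2 + 2 * (L0 * (delta * e)) ^+ 2.
  have := sqr_ge0 (a - 2 * b); lra.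
have d2 : 0 < delta ^+ 2 by rewrite exprn_gt0.
have -> : (a / delta) ^+ 2 * e ^+ 2 = a ^+ 2 * (e ^+ 2 / delta ^+ 2).
  by field; exact: lt0r_neq0.
have -> : 2 * b ^+ 2 / delta ^+ 2 * e ^+ 2 + 2 * L0 ^+ 2 * e ^+ 4 =
    (2 * b ^+ 2 + 2 * (L0 * (delta * e)) ^+ 2) * (e ^+ 2 / delta ^+ 2).
  by field; exact: lt0r_neq0.
by rewrite ler_wpM2r// divr_ge0// sqr_ge0.
Qed.

(** Consecutive queries differ by -eta g_t + delta (u_{t+1} - u_t). The first part gives the factor
    of E|g_t|^2, as g_t is independent of u_{t+1}. The second gives 4 L0^2 (|u_{t+1}|^4 + |u_t|^2
    |u_{t+1}|^2), of mean at most 4 L0^2 (3 d^2 + d^2). The same pointwise bound gives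
    integrability. *)
Lemma g_norm2_rec t : Int (fun w => enorm (g t w) ^+ 2) ->
  Int (fun w => enorm (g t.+1 w) ^+ 2) /\
  E (fun w => enorm (g t.+1 w) ^+ 2) <=
    2 * L0 ^+ 2 * eta ^+ 2 * d%:R / delta ^+ 2 * E (fun w => enorm (g t w) ^+ 2)
    + 16 * L0 ^+ 2 * d%:R ^+ 2.
Proof.
move=> ig.
have tS j i : (t, j) != (t.+1, i) :> nat * 'I_d by apply/eqP => -[/eqP]; rewrite ltn_eqF.
have [i1 e1] := moment_norm2 (Y := fun w => enorm (g t w) ^+ 2) (@off_g_norm2 t) (fun w => sqr_ge0 _) ig.
have [i2 e2] := u_norm2 t.
have [i3 e3] := moment_norm2 (t := t.+1) (Y := fun w => enorm (u t w) ^+ 2) (fun i => off_norm2_u (fun j => tS j i))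
  (fun w => sqr_ge0 _) i2.
have [i4 e4] := u_norm4 t.+1.
pose A := 2 * L0 ^+ 2 * eta ^+ 2 / delta ^+ 2.
have d2 : 0 < delta ^+ 2 by rewrite exprn_gt0.
have le w : enorm (g t.+1 w) ^+ 2 <= A * (enorm (g t w) ^+ 2 * enorm (u t.+1 w) ^+ 2) +
    (4 * L0 ^+ 2) * enorm (u t.+1 w) ^+ 4 +
    (4 * L0 ^+ 2) * (enorm (u t w) ^+ 2 * enorm (u t.+1 w) ^+ 2).
  rewrite g_norm2E /resid /=.
  have h := fL (q t.+1 w) (q t w).
  have qE : q t.+1 w - q t w = - (eta *: g t w) + delta *: (u t.+1 w - u t w).
    rewrite /query (rf_xS run); apply/rowP => j; rewrite !mxE; ring.
  have n1 : enorm (q t.+1 w - q t w) ^+ 2 <= 2 * (eta ^+ 2 * enorm (g t w) ^+ 2) +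
     4 * delta ^+ 2 * (enorm (u t.+1 w) ^+ 2 + enorm (u t w) ^+ 2).
    rewrite qE; apply: (le_trans (enormD_sqr_le _ _)); rewrite enormN !enormZ_sqr.
    have := enormD_sqr_le (u t.+1 w) (- u t w); rewrite enormN => n2.
    have := ler_wpM2l (ltW d2) n2; lra.
  have h2 : (f (q t.+1 w) - f (q t w)) ^+ 2 <= L0 ^+ 2 * enorm (q t.+1 w - q t w) ^+ 2.
    rewrite -exprMn -(real_normK (num_real (f _ - f _))) ler_sqr ?nnegrE//.
    by rewrite mulr_ge0 ?enorm_ge0.
  have h3 := le_trans h2 (ler_wpM2l (sqr_ge0 L0) n1).
  have h4 : 0 <= enorm (u t.+1 w) ^+ 2 / delta ^+ 2 by rewrite divr_ge0// sqr_ge0.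
  have := ler_wpM2r h4 h3.
  have dn0 : delta != 0 by exact: lt0r_neq0.
  set a := f _ - f _; set e := enorm (u t.+1 w); set e' := enorm (u t w); set b := enorm (g t w).
  have -> : (a / delta) ^+ 2 * e ^+ 2 = a ^+ 2 * (e ^+ 2 / delta ^+ 2) by field.
  move=> /le_trans; apply.
  rewrite le_eqVlt; apply/orP; left; apply/eqP; rewrite /A; field => //.
have ib := IntD (IntD (IntZ A i1) (IntZ (4 * L0 ^+ 2) i4)) (IntZ (4 * L0 ^+ 2) i3).
have igS : Int (fun w => enorm (g t.+1 w) ^+ 2).
  apply: (Int_dom _ ib); first by apply: mnorm2; exact: mg.
  by move=> w; rewrite ger0_norm ?sqr_ge0.
split=> //; apply: (le_trans (E_le igS ib le)).
rewrite !ED ?EZ//; [|exact: IntZ|exact: IntZ|exact: IntD (IntZ _ _) (IntZ _ _)|exact: IntZ].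
have A0 : 0 <= A.
  by apply: divr_ge0 (ltW d2); apply: mulr_ge0 (sqr_ge0 _); apply: mulr_ge0 => //; exact: sqr_ge0.
have L2 : 0 <= 4 * L0 ^+ 2 by rewrite mulr_ge0// sqr_ge0.
have := ler_wpM2l A0 e1; have := ler_wpM2l L2 e4; have := ler_wpM2l L2 e3.
have : 4 * L0 ^+ 2 * (d%:R * E (fun w => enorm (u t w) ^+ 2)) <= 4 * L0 ^+ 2 * (d%:R * d%:R).
  by rewrite ler_wpM2l// ler_wpM2l.
rewrite /A; lra.
Qed.

Let vL2 (X : T -> 'rV[R]_d) := forall j, L2 P (fun w => X w ord0 j).

Let vL2_cst z : vL2 (fun=> z).
Proof. by move=> j; exact: L2_cst. Qed.

Let vL2D X Y : vL2 X -> vL2 Y -> vL2 (fun w => X w + Y w).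
Proof. by move=> vX vY j; under eq_fun do rewrite mxE; exact: L2D. Qed.

Let vL2Z a X : vL2 X -> vL2 (fun w => a *: X w).
Proof. by move=> vX j; under eq_fun do rewrite mxE; exact: L2Z. Qed.

Let vL2B X Y : vL2 X -> vL2 Y -> vL2 (fun w => X w - Y w).
Proof. by move=> vX vY j; under eq_fun do rewrite !mxE; exact: L2B. Qed.

Let vL2_norm X : vL2 X -> Int (fun w => enorm (X w) ^+ 2).
Proof.
move=> vX; under eq_fun do rewrite enorm_sqr.
by apply: Int_sum => j; case: (vX j).
Qed.

Let vL2_dot X Y : vL2 X -> vL2 Y -> Int (fun w => dot (X w) (Y w)).
Proof. by move=> vX vY; apply: Int_sum => j; exact: L2_mul. Qed.

Lemma f_int X : vL2 X -> Int (fun w => f (X w)).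
Proof.
move=> vX; have iX := vL2_norm (vL2B vX (vL2_cst xs)).
apply: (Int_dom _ (IntD (Int_cst P (`|f xs| + L0)) (IntZ L0 iX))).
  by apply: (measurable_fun_continuous_rV _ cf) => j; case: (vX j).
move=> w; have h := fL (X w) xs.
have h1 : `|f (X w)| <= `|f xs| + `|f (X w) - f xs|.
  by rewrite -[leLHS](_ : `|f xs + (f (X w) - f xs)| = _) ?ler_normD// subrKC.
have h2 : enorm (X w - xs) <= 1 + enorm (X w - xs) ^+ 2.
  have := sqr_ge0 (enorm (X w - xs) - 1); have := sqr_ge0 (enorm (X w - xs)); lra.
have := ler_wpM2l L0_ge0 h2; lra.
Qed.

Lemma coord_sqr_le (y : 'rV[R]_d) j : y ord0 j ^+ 2 <= enorm y ^+ 2.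
Proof. by rewrite enorm_sqr (bigD1 j)//= lerDl sumr_ge0// => k _; exact: sqr_ge0. Qed.

Lemma coord_le (y : 'rV[R]_d) j : `|y ord0 j| <= enorm y.
Proof.
by rewrite -(@ler_sqr _ _ _) ?nnegrE ?enorm_ge0// real_normK ?num_real// coord_sqr_le.
Qed.

Let norm_vL2 (X : T -> 'rV[R]_d) : (forall j, measurable_fun setT (fun w => X w ord0 j)) ->
  Int (fun w => enorm (X w) ^+ 2) -> vL2 X.
Proof.
move=> mX iX j; split; first exact: mX.
apply: (Int_dom _ iX); first by apply: measurable_funX; exact: mX.
by move=> w; rewrite ger0_norm ?sqr_ge0// coord_sqr_le.
Qed.

Lemma g_norm2_int t : Int (fun w => enorm (g t w) ^+ 2).
Proof. by elim: t => [|t /g_norm2_rec[]//]; exact: g0_norm2_int. Qed.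

Let gL2 t : vL2 (g t).
Proof. by apply: norm_vL2 (g_norm2_int t) => j; exact: mg. Qed.

Let uL2 t : vL2 (u t).
Proof. by apply: norm_vL2 => [j|]; [exact: (mU (t, j))|have [] := u_norm2 t]. Qed.

Let xL2 t : vL2 (x t).
Proof.
elim: t => [|t IH] j.
  by under eq_fun do rewrite (rf_x0 run); exact: L2_cst.
by under eq_fun do rewrite (rf_xS run); exact: (vL2B IH (vL2Z eta (@gL2 t))).
Qed.

Let qL2 t : vL2 (q t).
Proof. by apply: vL2D => //; exact: vL2Z. Qed.

Let err t w := x t w - xs.

Let errL2 t : vL2 (err t).
Proof. exact: vL2B. Qed.

Let prefix (i : nat) (y : 'rV[R]_d) : 'rV[R]_d :=
  \row_j (if (j < i)%N then y ord0 j else 0).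

Let prefix_le i y : enorm (prefix i y) <= enorm y.
Proof.
rewrite -(@ler_sqr _ _ _) ?nnegrE ?enorm_ge0// !enorm_sqr.
by apply: ler_sum => j _; rewrite mxE; case: ifP => // _; rewrite expr0n sqr_ge0.
Qed.

Let prefixL2 i X : vL2 X -> vL2 (fun w => prefix i (X w)).
Proof.
move=> vX j; under eq_fun do rewrite mxE.
by case: (j < i)%N; [exact: vX|exact: L2_cst].
Qed.

(* Interpolates between [q t] and [q t - s *: err t], one coordinate at a time. *)
Let Q t s i w := q t w - s *: prefix i (err t w).

Let QL2 t s i : vL2 (Q t s i).
Proof. by apply: vL2B => //; apply: vL2Z; exact: prefixL2. Qed.

(** Stein's estimate with the noise coordinate [(t, i)] integrated out and shift [a], for which
    [delta * a] is the displacement s (x_t - xs)_i. The baseline put into [F] is constant in that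
    coordinate, so it leaves the Lipschitz constant alone while completing the product with [U p] to
    the estimate [g]. In the constant, [stein_cst] comes from [stein_freeze] and 2 from [r]. *)
Let stein_step t s (i : 'I_d) : 0 <= s ->
  E (fun w => f (Q t s i w) - f (Q t s i.+1 w)) <=
  s * E (fun w => err t w ord0 i * g t w ord0 i) +
  s ^+ 2 * (L0 / delta * (stein_cst + 2) * E (fun w => enorm (err t w) ^+ 2)).
Proof.
move=> s0; pose p := (t, i).
have dn0 : delta != 0 by exact: lt0r_neq0.
pose a w := s * err t w ord0 i / delta.
(* [V (w, z)] is [Q t s i w] with the [i]-th noise coordinate set to [z], so
   shifting that coordinate by [a w] turns it into [Q t s i.+1 w]. *)
pose V (y : G p * measurableTypeR R) : 'rV[R]_d := \row_j
  (if j == i then x t y.1 ord0 j + delta * y.2 else Q t s i y.1 ord0 j).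
pose F (y : G p * measurableTypeR R) : R := f (V y) - res t y.1.
have [ox ores] := @off_run t i t (leqnn t).
have mF : measurable_fun setT F.
  apply: measurable_funB; last exact: measurableT_comp.
  apply: (measurable_fun_continuous_rV _ cf) => j.
  under eq_fun do rewrite mxE.
  have [ji|ji] := boolP (j == i).
    apply: measurable_funD; first exact: (measurableT_comp (ox j)).
    exact: measurable_funM.
  apply: (@measurableT_comp _ _ _ _ _ _ (fun w : G p => Q t s i w ord0 j)) => //.
  under eq_fun do rewrite !mxE.
  apply: measurable_funB; last apply: measurable_funM => //.
    apply: measurable_funD; first exact: ox.
    apply: measurable_funM => //; apply: off_u.
    by apply/eqP => -[ij]; rewrite ij eqxx in ji.
  case: (j < i)%N; last exact: measurable_cst.
  by apply: measurable_funB => //; exact: ox.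
have ma : measurable_fun [set: G p] (a : G p -> R).
  apply: measurable_funM => //; apply: measurable_funM => //.
  under eq_fun do rewrite !mxE.
  by apply: measurable_funB => //; exact: ox.
have FL w z z' : `|F (w, z) - F (w, z')| <= L0 * delta * `|z - z'|.
  rewrite /F /= opprB addrA subrK.
  apply: (le_trans (fL _ _)); rewrite -mulrA ler_wpM2l//.
  have -> : V (w, z) - V (w, z') = (delta * (z - z')) *: delta_mx ord0 i.
    apply/rowP => j; rewrite !mxE /=; case: eqP => _; last by rewrite subrr mulr0.
    by rewrite mulr1; ring.
  rewrite enormZ normrM gtr0_norm// (_ : enorm _ = 1) ?mulr1//.
  apply/eqP; rewrite -(@eqrXn2 _ 2)// ?enorm_ge0// enorm_sqr (bigD1 i)//= big1.
    by rewrite mxE !eqxx expr1n addr0.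
  by move=> j ji; rewrite mxE (negbTE ji) andbF expr0n.
have FQ w : F (w, U p w) = f (Q t s i w) - res t w.
  congr (f _ - _); apply/rowP => j; rewrite !mxE /=.
  by case: eqP => // ->; rewrite ltnn mulr0 subr0.
have FQS w : F (w, U p w - a w) = f (Q t s i.+1 w) - res t w.
  congr (f _ - _); apply/rowP => j; rewrite !mxE /=.
  case: eqP => [->|ji].
    by rewrite ltnSn /a /U /= !mxE; field.
  rewrite (_ : (j < i.+1)%N = (j < i)%N)// ltnS leq_eqVlt.
  by case: eqP => // /val_inj.
have aE w : a w = s / delta * err t w ord0 i by rewrite /a; ring.
have La : L2 P a.
  by rewrite (_ : a = fun w => s / delta * err t w ord0 i); [apply: L2Z; exact: errL2|exact/funext].
have [mea ia2] := La.
have ierr := vL2_norm (@errL2 t).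
have oerr : measurable_fun [set: G p] ((fun w => enorm (err t w) ^+ 2) : G p -> R).
  under eq_fun do rewrite enorm_sqr.
  apply: measurable_sum => j; apply: measurable_funX; under eq_fun do rewrite !mxE.
  by apply: measurable_funB => //; exact: ox.
have [ierrU eerrU] := moment_mul2 oerr (fun w => sqr_ge0 _) ierr.
(* Stein's estimate yields [f] at [Q t s i], whereas [g t] evaluates it at [q t]; the two points are
   O(s) apart and [a] is O(s), so [r] is of order [s ^+ 2]. *)
pose r w := a w * ((f (Q t s i w) - f (q t w)) * U p w).
have sd0 : 0 <= s / delta by rewrite divr_ge0// ltW.
have ibr := IntZ (s ^+ 2 * (L0 / delta)) (IntD ierr ierrU).
have rle w : `|r w| <= s ^+ 2 * (L0 / delta) *
    (enorm (err t w) ^+ 2 + enorm (err t w) ^+ 2 * U p w ^+ 2).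
  rewrite /r normrM [X in _ * X]normrM.
  have h1 : `|a w| <= s / delta * enorm (err t w).
    by rewrite aE normrM ger0_norm// ler_wpM2l// coord_le.
  have h2 : `|f (Q t s i w) - f (q t w)| <= L0 * (s * enorm (err t w)).
    apply: (le_trans (fL _ _)); rewrite ler_wpM2l//.
    by rewrite /Q addrAC subrr add0r enormN enormZ ger0_norm// ler_wpM2l.
  have h3 : `|U p w| <= 1 + U p w ^+ 2.
    rewrite -(real_normK (num_real (U p w))).
    by have := sqr_ge0 (`|U p w| - 1); have := sqr_ge0 `|U p w|; lra.
  have h4 := ler_pM (normr_ge0 _) (normr_ge0 _) h2 h3.
  have m0 : 0 <= `|f (Q t s i w) - f (q t w)| * `|U p w| by rewrite mulr_ge0.
  apply: le_trans (ler_pM (normr_ge0 _) m0 h1 h4) _.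
  by rewrite le_eqVlt; apply/orP; left; apply/eqP; field.
have iQ := f_int (@QL2 t s i); have iQS := f_int (@QL2 t s i.+1).
have iq := f_int (@qL2 t).
have ir : Int r.
  apply: (Int_dom _ ibr) => //; apply: measurable_funM => //.
  apply: measurable_funM => //.
  exact: measurable_funB (Int_measurable iQ) (Int_measurable iq).
have ieg := L2_mul (@errL2 t i) (@gL2 t i).
have PsiE : (fun w => F (w, U p w) - F (w, U p w - a w) - a w * (F (w, U p w) * U p w)) =
    (fun w => (f (Q t s i w) - f (Q t s i.+1 w)) -
       (s * (err t w ord0 i * g t w ord0 i) + r w)).
  apply/funext => w; rewrite FQ FQS.
  rewrite (_ : g t w ord0 i = (f (q t w) - res t w) / delta * U p w); last first.
    by rewrite (run_gE _ _ run) mxE.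
  by rewrite /r aE; field.
have iD := IntB iQ iQS.
have iseg := IntZ s ieg.
have iPsi : Int (fun w => F (w, U p w) - F (w, U p w - a w) - a w * (F (w, U p w) * U p w)).
  by rewrite PsiE; exact: IntB iD (IntD iseg ir).
have h : E (fun w => (f (Q t s i w) - f (Q t s i.+1 w)) -
       (s * (err t w ord0 i * g t w ord0 i) + r w)) <=
    stein_cst * (L0 * delta) * E (fun w => a w ^+ 2).
  rewrite -PsiE; apply: (stein_freeze mU iU (gU p) mF ma _ FL ia2 iPsi).
  by rewrite mulr_ge0// ltW.
rewrite (EB iD (IntD iseg ir)) (ED iseg ir) (EZ s ieg) in h.
have er : E r <= s ^+ 2 * (L0 / delta) * (2 * E (fun w => enorm (err t w) ^+ 2)).
  apply: (@le_trans _ _ (s ^+ 2 * (L0 / delta) *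
      (E (fun w => enorm (err t w) ^+ 2) + E (fun w => enorm (err t w) ^+ 2 * U p w ^+ 2)))).
    rewrite -ED// -EZ//; last exact: IntD.
    by apply: E_le => // w; apply: le_trans (rle w); exact: ler_norm.
  have c0 : 0 <= s ^+ 2 * (L0 / delta).
    by apply: mulr_ge0 (sqr_ge0 _) _; apply: divr_ge0 => //; exact: ltW.
  by rewrite ler_wpM2l//; lra.
have ea : E (fun w => a w ^+ 2) <= s ^+ 2 / delta ^+ 2 * E (fun w => enorm (err t w) ^+ 2).
  rewrite -EZ//; apply: E_le => // [|w]; first exact: IntZ.
  rewrite aE exprMn (_ : (s / delta) ^+ 2 = s ^+ 2 / delta ^+ 2); last by field.
  by rewrite ler_wpM2l ?coord_sqr_le// divr_ge0// sqr_ge0.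
have C0 : 0 <= stein_cst * (L0 * delta) :> R.
  by rewrite mulr_ge0// ?mulr_ge0// ?(ltW delta_gt0)// (le_trans _ (stein_cst_ge2 (R := R))).
have := ler_wpM2l C0 ea.
have -> : stein_cst * (L0 * delta) *
    (s ^+ 2 / delta ^+ 2 * E (fun w => enorm (err t w) ^+ 2)) =
    s ^+ 2 * (L0 / delta * stein_cst * E (fun w => enorm (err t w) ^+ 2)) by field.
lra.
Qed.

Let queryS t w := xs + delta *: u t w.

Let queryS_L2 t : vL2 (queryS t).
Proof. by apply: vL2D => //; exact: vL2Z. Qed.

Let dot_int t : Int (fun w => dot (err t w) (g t w)).
Proof. exact: vL2_dot. Qed.

Hypothesis f_convex : convex_fun f.

(** The [d] increments of [stein_step] telescope from [q t] to the point on the segment. Their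
    errors sum to a finite multiple of [s ^+ 2], since x_t - xs is square integrable at each fixed
    time, and [ler_eps_sqr] discards it. *)
Lemma gradient_estimate_le t :
  E (fun w => f (q t w)) - E (fun w => f (xs + delta *: u t w)) <=
  E (fun w => dot (x t w - xs) (g t w)).
Proof.
have iq := f_int (@qL2 t); have iqs := f_int (@queryS_L2 t).
apply: (@ler_eps_sqr _ _ _
  (d%:R * (L0 / delta * (stein_cst + 2) * E (fun w => enorm (err t w) ^+ 2)))) => s s0 s1.
have iQ i := f_int (@QL2 t s i).
have tele : E (fun w => f (Q t s 0 w) - f (Q t s d w)) =
    \sum_(i < d) E (fun w => f (Q t s i w) - f (Q t s i.+1 w)).
  rewrite -E_sum; last by move=> i; exact: IntB.
  apply: eq_Rintegral => w _.
  have := telescope_sumr (fun i => f (Q t s i w)) (leq0n d).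
  rewrite -[LHS]opprK -sumrN big_mkord => /(congr1 -%R); rewrite opprK opprB => <-.
  by apply: eq_bigr => i _; rewrite opprB.
have le1 : s * (E (fun w => f (q t w)) - E (fun w => f (xs + delta *: u t w))) <=
    E (fun w => f (Q t s 0 w) - f (Q t s d w)).
  rewrite -EB// -EZ; last exact: IntB.
  apply: E_le => [| |w]; [by apply: IntZ; exact: IntB|exact: IntB|].
  have Q0 : Q t s 0 w = q t w.
    by rewrite /Q (_ : prefix 0 _ = 0) ?scaler0 ?subr0//; apply/rowP => j; rewrite !mxE.
  have Qd : Q t s d w = (1 - s) *: q t w + s *: (xs + delta *: u t w).
    apply/rowP => j; rewrite /Q !mxE ltn_ord; ring.
  rewrite Q0 Qd.
  have := convex_fun_le (q t w) (xs + delta *: u t w) f_convex (ltW s0) s1; lra.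
apply: (le_trans le1); rewrite tele.
apply: (le_trans (ler_sum _ (fun i _ => stein_step t i (ltW s0)))).
rewrite big_split/= -mulr_sumr sumr_const card_ord -E_sum; last first.
  by move=> i; exact: L2_mul (@errL2 t i) (@gL2 t i).
by rewrite lerD2l -mulr_natl; lra.
Qed.

Lemma distance_rec t :
  E (fun w => enorm (x t.+1 w - xs) ^+ 2) = E (fun w => enorm (x t w - xs) ^+ 2)
    - 2 * eta * E (fun w => dot (x t w - xs) (g t w)) + eta ^+ 2 * E (fun w => enorm (g t w) ^+ 2).
Proof.
have i1 := vL2_norm (@errL2 t); have i2 := @dot_int t; have i3 := g_norm2_int t.
rewrite -EZ// -EB//; last exact: IntZ.
rewrite -EZ// -ED//; [|by apply: IntB => //; exact: IntZ|exact: IntZ].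
apply: eq_Rintegral => w _.
have -> : x t.+1 w - xs = (x t w - xs) - eta *: g t w by rewrite (rf_xS run) addrAC.
by rewrite (enormB_sqr (x t w - xs)) enormZ_sqr dotZr mulrA.
Qed.

Lemma fx_int t : Int (fun w => f (x t w)).
Proof. exact: f_int. Qed.

(** Each of the two replacements costs L0 delta E|u|. The crude bound |u| <= (1 + |u|^2) / 2 gives
    E|u| <= d, as d >= 1; this is all that a rate linear in [d] requires. *)
Lemma lipschitz_gap_le t : E (fun w => f (x t w)) - f xs <=
  E (fun w => dot (x t w - xs) (g t w)) + 2 * (L0 * delta * d%:R).
Proof.
have h := gradient_estimate_le t.
have iq := f_int (@qL2 t); have iqs := f_int (@queryS_L2 t).
have [iu eu] := u_norm2 t.
have le (y v : 'rV[R]_d) : `|f y - f (y + delta *: v)| <= L0 * delta * ((1 + enorm v ^+ 2) / 2).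
  apply: (le_trans (fL _ _)); rewrite -mulrA ler_wpM2l//.
  rewrite opprD addrA subrr add0r enormN enormZ gtr0_norm// (ler_wpM2l (ltW delta_gt0))//.
  have := sqr_ge0 (enorm v - 1); lra.
have iB : Int (fun w => L0 * delta * ((1 + enorm (u t w) ^+ 2) / 2)).
  apply: IntZ; under eq_fun do rewrite mulrC; apply: IntZ; apply: IntD => //.
  exact: Int_cst.
have eB : E (fun w => L0 * delta * ((1 + enorm (u t w) ^+ 2) / 2)) <= L0 * delta * d%:R.
  have i1u := IntD (Int_cst P 1) iu.
  have -> : E (fun w => L0 * delta * ((1 + enorm (u t w) ^+ 2) / 2)) =
      E (fun w => (L0 * delta / 2) * (1 + enorm (u t w) ^+ 2)).
    by apply: eq_Rintegral => w _; ring.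
  rewrite EZ// ED// ?E_cst; last exact: Int_cst.
  have d1 : 1 <= d%:R :> R by rewrite ler1n.
  have LD : 0 <= L0 * delta by rewrite mulr_ge0// ltW.
  have : L0 * delta * (1 + E (fun w => enorm (u t w) ^+ 2)) <= L0 * delta * (2 * d%:R).
    by rewrite ler_wpM2l//; lra.
  lra.
have h1 : E (fun w => f (x t w)) - E (fun w => f (q t w)) <= L0 * delta * d%:R.
  rewrite -EB//; last exact: fx_int.
  apply: le_trans eB; apply: E_le => // [|w]; first by apply: IntB => //; exact: fx_int.
  by apply: le_trans (le _ _); exact: ler_norm.
have h2 : E (fun w => f (xs + delta *: u t w)) - f xs <= L0 * delta * d%:R.
  rewrite -(E_cst P (f xs)) -EB//; last exact: Int_cst.
  apply: le_trans eB; apply: E_le => // [|w]; first by apply: IntB => //; exact: Int_cst.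
  by apply: le_trans (le _ _); rewrite distrC; exact: ler_norm.
lra.
Qed.

(** * Sharper gap and second-moment bounds under smoothness *)

Section smooth.
Variable L1 : R.
Hypothesis L1_gt0 : 0 < L1.
Hypothesis f_smooth : lipschitz_gradient_const L1 f.
Hypothesis xs_min : global_minimizer f xs.

Let off_gradient t i s j : (s <= t)%N ->
  measurable_fun [set: G (t, i)] ((fun w => gradient f (x s w) ord0 j) : G (t, i) -> R).
Proof.
move=> st; have [ox _] := @off_run t i s st.
apply: (measurable_fun_continuous_rV (X := fun w : G (t, i) => x s w)
  (f := fun y => gradient f y ord0 j)) => //.
exact: (continuous_gradient f_smooth (ltW L1_gt0)).
Qed.

Let off_gradient2 t i s : (s <= t)%N ->
  measurable_fun [set: G (t, i)] ((fun w => enorm (gradient f (x s w)) ^+ 2) : G (t, i) -> R).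
Proof.
move=> st; under eq_fun do rewrite enorm_sqr.
by apply: measurable_sum => j; apply: measurable_funX; exact: off_gradient.
Qed.

Let gradient2_int t : Int (fun w => enorm (gradient f (x t w)) ^+ 2).
Proof.
have ib := IntZ (2 * L1) (IntB (fx_int t) (Int_cst P (f xs))).
apply: (Int_dom _ ib).
  exact: off_mfun (@off_gradient2 t (Ordinal d_gt0) t (leqnn t)).
move=> w; rewrite ger0_norm ?sqr_ge0//.
exact: (gradient_minimizer_sqr_le f_smooth (ltW L1_gt0) _ L1_gt0 xs_min).
Qed.

Let gradient2_le t : E (fun w => enorm (gradient f (x t w)) ^+ 2) <=
  2 * L1 * (E (fun w => f (x t w)) - f xs).
Proof.
rewrite -(E_cst P (f xs)) -EB; [|exact: fx_int|exact: Int_cst].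
have i := IntB (fx_int t) (Int_cst P (f xs)).
rewrite -EZ//; apply: E_le => // [|w]; first exact: IntZ.
exact: (gradient_minimizer_sqr_le f_smooth (ltW L1_gt0) _ L1_gt0 xs_min).
Qed.

Let gradientL2 t : vL2 (fun w => gradient f (x t w)).
Proof.
apply: norm_vL2 => // j.
exact: off_mfun (@off_gradient t (Ordinal d_gt0) t j (leqnn t)).
Qed.

(* The expectation is in fact [0] by independence; the instance of [stein_freeze]
   with [F] constant in the frozen coordinate gives this half directly. *)
Let gradient_noise_ge0 t : 0 <= E (fun w => dot (gradient f (x t w)) (u t w)).
Proof.
rewrite E_sum; last by move=> j; exact: L2_mul (@gradientL2 t j) (@uL2 t j).
apply: sumr_ge0 => i _; pose p := (t, i).
pose F (y : G p * measurableTypeR R) : R := gradient f (x t y.1) ord0 i.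
have mF : measurable_fun setT F.
  exact: (measurableT_comp (@off_gradient t i t i (leqnn t))).
have iF := L2_mul (@gradientL2 t i) (@uL2 t i).
have ma : measurable_fun [set: G p] ((fun=> 1) : G p -> R) by exact: measurable_cst.
have FE : (fun w => F (w, U p w) - F (w, U p w - 1) - 1 * (F (w, U p w) * U p w)) =
    (fun w => -1 * (gradient f (x t w) ord0 i * u t w ord0 i)).
  by apply/funext => w; rewrite /F /= subrr mul1r sub0r mulN1r.
have : E (fun w => F (w, U p w) - F (w, U p w - 1) - 1 * (F (w, U p w) * U p w)) <=
    stein_cst * 0 * E (fun w => 1 ^+ 2).
  apply: (stein_freeze mU iU (gU p) (a := fun=> 1) mF ma) => //.
  - by move=> w z z'; rewrite /F /= subrr normr0 mul0r.
  - exact: Int_cst.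
  - by rewrite FE; exact: IntZ.
by rewrite FE EZ// mulr0 mul0r mulN1r oppr_le0.
Qed.

(** The two replacements are not symmetric. At x_t the first-order convexity bound shows that the
    noise cannot lower the mean value, so nothing is paid. At xs the gradient vanishes and [descent]
    leaves only the quadratic term. *)
Lemma smooth_gap_le t : E (fun w => f (x t w)) - f xs <=
  E (fun w => dot (x t w - xs) (g t w)) + L1 / 2 * delta ^+ 2 * d%:R.
Proof.
have h := gradient_estimate_le t.
have iq := f_int (@qL2 t); have iqs := f_int (@queryS_L2 t).
have [iu eu] := u_norm2 t.
have id := vL2_dot (@gradientL2 t) (@uL2 t).
have h1 : E (fun w => f (x t w)) <= E (fun w => f (q t w)).
  apply: (@le_trans _ _ (E (fun w => f (x t w) + delta * dot (gradient f (x t w)) (u t w)))).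
    rewrite ED ?EZ//; [|exact: fx_int|exact: IntZ].
    by rewrite lerDl mulr_ge0// ltW.
  apply: E_le => // [|w]; first by apply: IntD; [exact: fx_int|exact: IntZ].
  rewrite -dotZr; exact: (gradient_le f_smooth (ltW L1_gt0)).
have c0 : 0 <= L1 / 2 * delta ^+ 2 by rewrite mulr_ge0 ?sqr_ge0// divr_ge0// ltW.
have h2 : E (fun w => f (xs + delta *: u t w)) <= f xs + L1 / 2 * delta ^+ 2 * d%:R.
  apply: (@le_trans _ _ (E (fun w => f xs + L1 / 2 * delta ^+ 2 * enorm (u t w) ^+ 2))).
    apply: E_le => // [|w]; first by apply: IntD; [exact: Int_cst|exact: IntZ].
    apply: (le_trans (descent f_smooth (ltW L1_gt0) _ _)).
    rewrite enormZ_sqr (mulrA (L1 / 2)) lerD2r gerDl.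
    apply: (le_trans (dot_le _ _)).
    by rewrite (gradient_minimizer0 f_smooth (ltW L1_gt0) L1_gt0 xs_min) mul0r.
  rewrite ED ?EZ ?E_cst//; [|exact: Int_cst|exact: IntZ].
  by rewrite lerD2l ler_wpM2l.
lra.
Qed.

(** Convexity and [descent] place the increment between its linear part and that part plus a
    quadratic. The linear part is bounded by the gradient norm, which later becomes an optimality
    gap. *)
Let smooth_step_sqr_le (y v : 'rV[R]_d) :
  (f (y + delta *: v) - f y) ^+ 2 <= 2 * delta ^+ 2 * (enorm (gradient f y) ^+ 2 * enorm v ^+ 2)
    + L1 ^+ 2 / 2 * delta ^+ 4 * enorm v ^+ 4.
Proof.
have h1 := gradient_le f_smooth (ltW L1_gt0) y (delta *: v) f_convex.
have h2 := descent f_smooth (ltW L1_gt0) y (delta *: v).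
rewrite enormZ_sqr in h2; rewrite !dotZr in h1 h2.
have h3 := dot_sqr_le (gradient f y) v.
set a := f (y + _) - f y; set b := dot _ _ in h1 h2 h3.
set e := enorm v in h2 h3 *; set k := enorm _ in h3 *.
have c0 : 0 <= L1 / 2 * (delta ^+ 2 * e ^+ 2).
  by rewrite mulr_ge0 ?divr_ge0 ?(ltW L1_gt0)// -exprMn sqr_ge0.
have h : a ^+ 2 <= 2 * (delta * b) ^+ 2 + 2 * (L1 / 2 * (delta ^+ 2 * e ^+ 2)) ^+ 2.
  have [ab|ab] := lerP (delta * b) 0.
    have : `|a| <= `|delta * b| + L1 / 2 * (delta ^+ 2 * e ^+ 2).
      rewrite (ler0_norm ab) ler_norml; apply/andP; split; rewrite /a; lra.
    move=> ha; rewrite -(real_normK (num_real a)) -(real_normK (num_real (delta * b))).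
    have : `|a| ^+ 2 <= (`|delta * b| + L1 / 2 * (delta ^+ 2 * e ^+ 2)) ^+ 2.
      by rewrite ler_sqr ?nnegrE ?addr_ge0.
    have := sqr_ge0 (`|delta * b| - L1 / 2 * (delta ^+ 2 * e ^+ 2)); lra.
  have a0 : 0 <= a by rewrite /a; lra.
  have : a ^+ 2 <= (delta * b + L1 / 2 * (delta ^+ 2 * e ^+ 2)) ^+ 2.
    have s0 : 0 <= delta * b + L1 / 2 * (delta ^+ 2 * e ^+ 2) by rewrite addr_ge0// ltW.
    by rewrite ler_sqr ?nnegrE// /a; lra.
  have := sqr_ge0 (delta * b - L1 / 2 * (delta ^+ 2 * e ^+ 2)); lra.
have := ler_wpM2l (sqr_ge0 delta) h3.
lra.
Qed.

(** The difference of query values passes through f(x_{t+1}) and f(x_t): three terms, hence the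
    factor 3. The middle one is Lipschitz in the step eta g_t; the outer ones use
    [smooth_step_sqr_le]. With |grad f|^2 <= 2 L1 gap, the fourth moment of u_{t+1} gives 36 = 6 * 3
    * 2, and the product of two second moments gives 12 = 6 * 2. The last term collects |u_{t+1}|^6
    and |u_t|^4 |u_{t+1}|^2. *)
Lemma smooth_g_norm2_rec t :
  E (fun w => enorm (g t.+1 w) ^+ 2) <=
    3 * L0 ^+ 2 * eta ^+ 2 * d%:R / delta ^+ 2 * E (fun w => enorm (g t w) ^+ 2)
    + 36 * L1 * d%:R ^+ 2 * (E (fun w => f (x t.+1 w)) - f xs)
    + 12 * L1 * d%:R ^+ 2 * (E (fun w => f (x t w)) - f xs)
    + 3 / 2 * L1 ^+ 2 * delta ^+ 2 * (normal_m6 + 3) * d%:R ^+ 3.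
Proof.
have tS j i : (t, j) != (t.+1, i) :> nat * 'I_d by apply/eqP => -[/eqP]; rewrite ltn_eqF.
have ig := g_norm2_int t.
have [i1 e1] := moment_norm2 (Y := fun w => enorm (g t w) ^+ 2) (@off_g_norm2 t)
  (fun w => sqr_ge0 _) ig.
have [i2 e2] := moment_norm4 (t := t.+1) (Y := fun w => enorm (gradient f (x t.+1 w)) ^+ 2)
  (fun i => @off_gradient2 t.+1 i t.+1 (leqnn _)) (fun w => sqr_ge0 _) (gradient2_int t.+1) d_gt0.
have [i3 e3] := u_norm6 t.+1.
have [i4 e4] := moment_norm2 (t := t) (Y := fun w => enorm (gradient f (x t w)) ^+ 2)
  (fun i => @off_gradient2 t i t (leqnn _)) (fun w => sqr_ge0 _) (gradient2_int t).
have [i5 e5] := moment_norm2 (t := t.+1)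
  (Y := fun w => enorm (gradient f (x t w)) ^+ 2 * enorm (u t w) ^+ 2)
  (fun i => measurable_funM (@off_gradient2 t.+1 i t (leqnSn t)) (off_norm2_u (fun j => tS j i)))
  (fun w => mulr_ge0 (sqr_ge0 _) (sqr_ge0 _)) i4.
have [i6 e6] := u_norm4 t.
have off4 i : measurable_fun [set: G (t.+1, i)] ((fun w => enorm (u t w) ^+ 4) : G (t.+1, i) -> R).
  under eq_fun do rewrite (exprM _ 2 2).
  by apply: measurable_funX; exact: off_norm2_u (fun j => tS j i).
have [i7 e7] := moment_norm2 (t := t.+1) (Y := fun w => enorm (u t w) ^+ 4) off4
  (fun w => exprn_even_ge0 (enorm (u t w)) (n := 4) isT) i6.
pose A := 3 * L0 ^+ 2 * eta ^+ 2 / delta ^+ 2.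
pose B := 3 / 2 * L1 ^+ 2 * delta ^+ 2.
have d2 : 0 < delta ^+ 2 by rewrite exprn_gt0.
have dn0 : delta != 0 by exact: lt0r_neq0.
have le w : enorm (g t.+1 w) ^+ 2 <=
    A * (enorm (g t w) ^+ 2 * enorm (u t.+1 w) ^+ 2) +
    6 * (enorm (gradient f (x t.+1 w)) ^+ 2 * enorm (u t.+1 w) ^+ 4) +
    B * enorm (u t.+1 w) ^+ 6 +
    6 * (enorm (gradient f (x t w)) ^+ 2 * enorm (u t w) ^+ 2 * enorm (u t.+1 w) ^+ 2) +
    B * (enorm (u t w) ^+ 4 * enorm (u t.+1 w) ^+ 2).
  rewrite g_norm2E /resid /=.
  have ha := smooth_step_sqr_le (x t.+1 w) (u t.+1 w).
  have hc := smooth_step_sqr_le (x t w) (u t w).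
  have hb : (f (x t.+1 w) - f (x t w)) ^+ 2 <= L0 ^+ 2 * (eta ^+ 2 * enorm (g t w) ^+ 2).
    have := fL (x t.+1 w) (x t w).
    rewrite (rf_xS run) addrAC subrr add0r enormN => h.
    rewrite -enormZ_sqr -exprMn -(real_normK (num_real (f _ - f _))).
    by rewrite ler_sqr ?nnegrE// mulr_ge0 ?enorm_ge0.
  rewrite -/(query delta u x t.+1 w) in ha; rewrite -/(query delta u x t w) in hc.
  set a := f (q t.+1 w) in ha *; set b := f (x t.+1 w) in ha hb; set c := f (x t w) in hb hc.
  set a' := f (q t w) in hc *.
  have h3 : (a - a') ^+ 2 <= 3 * ((a - b) ^+ 2 + (b - c) ^+ 2 + (a' - c) ^+ 2).
    by rewrite (_ : a - a' = (a - b) + (b - c) - (a' - c)) ?sqr_add3_le//; ring.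
  have h4 : 0 <= enorm (u t.+1 w) ^+ 2 / delta ^+ 2 by rewrite divr_ge0// sqr_ge0.
  have h5 := le_trans h3 (ler_wpM2l (ler0n R 3) (lerD (lerD ha hb) hc)).
  have := ler_wpM2r h4 h5.
  set e := enorm (u t.+1 w); set e' := enorm (u t w); set gg := enorm (g t w).
  set k := enorm (gradient f (x t.+1 w)); set k' := enorm (gradient f (x t w)).
  have -> : ((a - a') / delta) ^+ 2 * e ^+ 2 = (a - a') ^+ 2 * (e ^+ 2 / delta ^+ 2) by field.
  move=> /le_trans; apply.
  by rewrite le_eqVlt; apply/orP; left; apply/eqP; rewrite /A /B; field.
have j1 := IntZ A i1; have j2 := IntZ 6 i2; have j3 := IntZ B i3.
have j5 := IntZ 6 i5; have j7 := IntZ B i7.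
have ib := IntD (IntD (IntD (IntD j1 j2) j3) j5) j7.
apply: (le_trans (E_le (g_norm2_int t.+1) ib le)).
rewrite (ED (IntD (IntD (IntD j1 j2) j3) j5) j7) (ED (IntD (IntD j1 j2) j3) j5).
rewrite (ED (IntD j1 j2) j3) (ED j1 j2) (EZ A i1) (EZ 6 i2) (EZ B i3) (EZ 6 i5) (EZ B i7).
have A0 : 0 <= A.
  by apply: divr_ge0 (ltW d2); apply: mulr_ge0 (sqr_ge0 _); apply: mulr_ge0 => //; exact: sqr_ge0.
have B0 : 0 <= B.
  by apply: mulr_ge0 (ltW d2); apply: mulr_ge0 (sqr_ge0 _); rewrite divr_ge0.
have dd : 0 <= d%:R :> R by [].
have k1 := ler_wpM2l A0 e1.
have k2 := le_trans e2 (ler_wpM2l (mulr_ge0 (ler0n R 3) (sqr_ge0 d%:R)) (gradient2_le t.+1)).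
have k3 := ler_wpM2l B0 e3.
have k5 := le_trans e5 (ler_wpM2l dd (le_trans e4 (ler_wpM2l dd (gradient2_le t)))).
have k7 := ler_wpM2l B0 (le_trans e7 (ler_wpM2l dd e6)).
have six : 0 <= 6 :> R by [].
apply: (le_trans (lerD (lerD (lerD (lerD k1 (ler_wpM2l six k2)) k3) (ler_wpM2l six k5)) k7)).
by rewrite le_eqVlt; apply/orP; left; apply/eqP; rewrite /A /B; field.
Qed.

End smooth.
End residual_process.

(** * Rates *)

Section real_sequences.
Context {R : realType}.

Lemma descent_sum (eta B : R) (D F G : nat -> R) (n : nat) :
  (forall t, D t.+1 <= D t - 2 * eta * (F t - B) + eta ^+ 2 * G t) ->
  (forall t, 0 <= D t) ->
  2 * eta * \sum_(t < n) F t <= D 0%N + n%:R * (2 * eta * B) + eta ^+ 2 * \sum_(t < n) G t.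
Proof.
move=> h D0.
suff : 2 * eta * \sum_(t < n) F t + D n <=
    D 0%N + n%:R * (2 * eta * B) + eta ^+ 2 * \sum_(t < n) G t by have := D0 n; lra.
elim: n => [|n IH]; first by rewrite !big_ord0; lra.
by rewrite !big_ord_recr/= -natr1; have := h n; lra.
Qed.

(** The induction carries the extra [2 * G n]: since [2 * G n.+1 <= G n + 2 * V], it pays for the
    next summand and the next extra term. *)
Lemma sum_contraction (V : R) (G : nat -> R) (n : nat) :
  (forall t, G t.+1 <= G t / 2 + V) -> (forall t, 0 <= G t) ->
  \sum_(t < n) G t <= 2 * G 0%N + 2 * (n%:R * V).
Proof.
move=> h G0.
suff : \sum_(t < n) G t + 2 * G n <= 2 * G 0%N + 2 * (n%:R * V) by have := G0 n; lra.
elim: n => [|n IH]; first by rewrite big_ord0; lra.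
by rewrite big_ord_recr/= -natr1; have := h n; lra.
Qed.

(** The sum of [G] stays on both sides, since [al] is small only for the chosen stepsize;
    [smooth_rate] solves for it. In the induction the [F t.+1] start at time 1, hence the subtracted
    [F 0]. *)
Lemma sum_coupled (al a b V : R) (F G : nat -> R) (n : nat) :
  0 <= al -> 0 <= a -> 0 <= b -> 0 <= V ->
  (forall t, G t.+1 <= al * G t + a * F t.+1 + b * F t + V) ->
  (forall t, 0 <= F t) -> (forall t, 0 <= G t) ->
  \sum_(t < n) G t <= G 0%N + al * \sum_(t < n) G t + (a + b) * \sum_(t < n) F t + n%:R * V.
Proof.
move=> al0 a0 b0 V0 h F0 G0.
case: n => [|n]; first by rewrite !big_ord0; have := G0 0%N; lra.
suff : \sum_(t < n.+1) G t <= G 0%N + al * \sum_(t < n) G t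
    + a * (\sum_(t < n.+1) F t - F 0%N) + b * \sum_(t < n) F t + n%:R * V.
  rewrite -natr1 => h1; apply: (le_trans h1).
  have := mulr_ge0 al0 (G0 n); have := mulr_ge0 a0 (F0 0%N); have := mulr_ge0 b0 (F0 n).
  by rewrite !(big_ord_recr n)/=; lra.
elim: n => [|n IH]; first by rewrite !big_ord_recr/= !big_ord0; lra.
rewrite big_ord_recr/= [X in a * (X - _)]big_ord_recr/= [X in al * X]big_ord_recr/=.
by rewrite [X in b * X]big_ord_recr/= -natr1; have := h n; lra.
Qed.

(** Here [s] is the square root of T. After multiplication by d L0 / s, the 10 is 2 from the bias of
    replacing queries by iterates plus 8 from the second moments; the term in [G0] decays faster
    than the rate. *)
Lemma lipschitz_rate (L0 d s D0 G0 S : R) : 0 < L0 -> 1 <= d -> 1 <= s ->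
  0 <= G0 ->
  2 * (1 / (2 * d * L0 * s)) * S <=
    D0 + s ^+ 2 * (2 * (1 / (2 * d * L0 * s)) * (2 * (L0 * (1 / s) * d))) +
    (1 / (2 * d * L0 * s)) ^+ 2 * (2 * G0 + 2 * (s ^+ 2 * (16 * L0 ^+ 2 * d ^+ 2))) ->
  (s ^+ 2)^-1 * S <= (D0 * L0 + 10 * L0 + G0 / (2 * L0)) * (d * s^-1).
Proof.
move=> L00 d1 s1 G00 h.
have d0 : 0 < d by lra.
have s0 : 0 < s by lra.
have c0 : 0 <= d * L0 / s by rewrite divr_ge0 ?mulr_ge0// ltW.
have := ler_wpM2l c0 h.
have -> : d * L0 / s * (2 * (1 / (2 * d * L0 * s)) * S) = (s ^+ 2)^-1 * S.
  by field; rewrite !lt0r_neq0.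
move=> /le_trans; apply.
have g1 : G0 / (2 * L0) * (1 / (d * s ^+ 3)) <= G0 / (2 * L0) * (d * s^-1).
  rewrite ler_wpM2l//; first by rewrite divr_ge0// mulr_ge0// ltW.
  rewrite ler_pdivrMr; last by rewrite mulr_gt0// exprn_gt0.
  have -> : d * s^-1 * (d * s ^+ 3) = d ^+ 2 * s ^+ 2 by field; exact: lt0r_neq0.
  by rewrite mulr_ege1// exprn_ege1.
have -> : d * L0 / s * (D0 + s ^+ 2 * (2 * (1 / (2 * d * L0 * s)) * (2 * (L0 * (1 / s) * d))) +
    (1 / (2 * d * L0 * s)) ^+ 2 * (2 * G0 + 2 * (s ^+ 2 * (16 * L0 ^+ 2 * d ^+ 2)))) =
    (D0 * L0 + 10 * L0) * (d * s^-1) + G0 / (2 * L0) * (1 / (d * s ^+ 3)).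
  by field; rewrite !lt0r_neq0.
lra.
Qed.

(** Here [c] is the cube root of T, [d / c ^+ 2] is the square of delta, and [S] and [SG] are the
    sums of gaps and of second moments. Both are unknown: the second hypothesis bounds [SG] by [S],
    and the first then bounds [S]. *)
Lemma smooth_rate (L0 L1 Lt d c D0 G0 m S SG : R) : 0 < L0 -> 0 < L1 -> L0 <= Lt -> 16 * L1 <= Lt ->
  1 <= d -> 1 <= c -> 0 <= D0 -> 0 <= G0 -> 0 <= m -> 0 <= S -> 0 <= SG ->
  let eta := 1 / (2 * Lt * (d + 4) ^+ 2 * c) in
  let V := 3 / 2 * L1 ^+ 2 * (d / c ^+ 2) * (m + 3) * d ^+ 3 in
  2 * eta * S <= D0 + c ^+ 3 * (2 * eta * (L1 / 2 * (d / c ^+ 2) * d)) + eta ^+ 2 * SG ->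
  SG <= G0 + 3 * L0 ^+ 2 * eta ^+ 2 * d / (d / c ^+ 2) * SG + (36 * L1 * d ^+ 2 + 12 * L1 * d ^+ 2) * S
    + c ^+ 3 * V ->
  (c ^+ 3)^-1 * S <= (110 * Lt * D0 + 11 / 5 * L1 + 11 / 5 * (G0 / L0 + 3 / 2 * L1 ^+ 2 * (m + 3) / L0))
     * (d ^+ 2 * (c ^+ 2)^-1).
Proof.
move=> L00 L10 LL0 LL1 d1 c1 D00 G00 m0 S0 SG0 eta V h1 h2.
have d0 : 0 < d by lra.
have c0 : 0 < c by lra.
have Lt0 : 0 < Lt by lra.
have d4 : 0 < d + 4 by lra.
have den0 : 0 < 2 * Lt * (d + 4) ^+ 2 * c by rewrite !mulr_gt0// exprn_gt0.
have e0 : 0 < eta by rewrite divr_gt0.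
have V0 : 0 <= V.
  rewrite /V mulr_ge0 ?exprn_ge0 ?(ltW d0)// mulr_ge0 ?addr_ge0// mulr_ge0//.
    by rewrite mulr_ge0 ?sqr_ge0.
  by rewrite divr_ge0 ?sqr_ge0// ltW.
(* Both [d] and [c] cancel, up to (d + 4)^4 >= 625 in the denominator; [L0 <= Lt] bounds the
   rest. *)
have al : 3 * L0 ^+ 2 * eta ^+ 2 * d / (d / c ^+ 2) <= 1 / 100.
  have -> : 3 * L0 ^+ 2 * eta ^+ 2 * d / (d / c ^+ 2) =
      (L0 / Lt) ^+ 2 * (3 / 4 * (1 / (d + 4) ^+ 4)).
    by rewrite /eta; field; rewrite !lt0r_neq0.
  have r1 : (L0 / Lt) ^+ 2 <= 1.
    by rewrite expr_le1// ?ler_pdivrMr ?mul1r// divr_ge0// ltW.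
  have r2 : 1 / (d + 4) ^+ 4 <= 1 / 625.
    have : (5 : R) ^+ 4 <= (d + 4) ^+ 4 by rewrite ler_pXn2r ?nnegrE//; lra.
    rewrite (_ : (5 : R) ^+ 4 = 625); last by ring.
    by move=> r; rewrite ler_pdivrMr ?exprn_gt0//; lra.
  have r3 : 0 <= 3 / 4 * (1 / (d + 4) ^+ 4).
    by rewrite mulr_ge0// divr_ge0// exprn_ge0// ltW.
  have := ler_wpM2r r3 r1; lra.
(* Solving for [SG] costs 1 / (1 - 1/100), rounded up to 102/100. *)
have SGle : SG <= 102 / 100 * (G0 + 48 * L1 * d ^+ 2 * S + c ^+ 3 * V).
  have := ler_wpM2r SG0 al; have : 0 <= G0 + 48 * L1 * d ^+ 2 * S + c ^+ 3 * V.
    rewrite !addr_ge0//; last by rewrite mulr_ge0// exprn_ge0// ltW.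
    by rewrite mulr_ge0// mulr_ge0 ?sqr_ge0// mulr_ge0// ltW.
  lra.
(* The 16 in [16 * L1 <= Lt] is used here; the factor 153/100 below is 48/32 times 102/100. *)
have eL : eta * (L1 * d ^+ 2) <= 1 / 32.
  rewrite /eta mul1r mulrC ler_pdivrMr//.
  have x1 : d ^+ 2 <= (d + 4) ^+ 2 * c.
    apply: (@le_trans _ _ ((d + 4) ^+ 2 * 1)); last by rewrite ler_wpM2l ?sqr_ge0.
    by rewrite mulr1 ler_sqr ?nnegrE ?ltW//; lra.
  have x2 : L1 * d ^+ 2 <= L1 * ((d + 4) ^+ 2 * c) by rewrite ler_wpM2l// ltW.
  have x3 : 16 * L1 * ((d + 4) ^+ 2 * c) <= Lt * ((d + 4) ^+ 2 * c).
    by rewrite ler_wpM2r// mulr_ge0 ?sqr_ge0// ltW.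
  lra.
have h3 : eta ^+ 2 * SG <= eta ^+ 2 * (102 / 100 * (G0 + c ^+ 3 * V)) + 153 / 100 * (eta * S).
  have := ler_wpM2l (sqr_ge0 eta) SGle.
  have := ler_wpM2r (mulr_ge0 (ltW e0) S0) eL.
  lra.
pose B := L1 / 2 * (d / c ^+ 2) * d.
(* The stepsize leaves a factor at most [153 / 100 < 2] in front of [eta * S] in
   [h3], so that it is absorbed by the left-hand side of [h1]. *)
have h4 : 47 / 100 * (eta * S) <= D0 + c ^+ 3 * (2 * eta * B) +
    eta ^+ 2 * (102 / 100 * (G0 + c ^+ 3 * V)) by rewrite /B; lra.
have c3 : 0 < c ^+ 3 by rewrite exprn_gt0.
have k0 : 0 <= (100 / 47) / (eta * c ^+ 3) by rewrite divr_ge0// mulr_ge0// ltW.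
have := ler_wpM2l k0 h4.
have en : eta != 0 by exact: lt0r_neq0.
have -> : (100 / 47) / (eta * c ^+ 3) * (47 / 100 * (eta * S)) = (c ^+ 3)^-1 * S.
  by field; rewrite en lt0r_neq0.
move=> /le_trans; apply.
(* Initial distance, bias, initial second moment and source [V]. With d + 4 <= 5 d the first
   coefficient becomes 5000/47, rounded up to 110; the others, 100/47 and 102/47, are rounded up to
   11/5. *)
have -> : (100 / 47) / (eta * c ^+ 3) * (D0 + c ^+ 3 * (2 * eta * B) +
    eta ^+ 2 * (102 / 100 * (G0 + c ^+ 3 * V))) =
    100 / 47 * (D0 * (1 / (eta * c ^+ 3))) + 200 / 47 * B +
    102 / 47 * (eta * G0 / c ^+ 3) + 102 / 47 * (eta * V).
  by field; rewrite en lt0r_neq0.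
pose q := d ^+ 2 * (c ^+ 2)^-1.
have q0 : 0 < q by rewrite mulr_gt0 ?invr_gt0 ?exprn_gt0.
have p1 : D0 * (1 / (eta * c ^+ 3)) <= D0 * (50 * Lt * q).
  rewrite ler_wpM2l//.
  have -> : 1 / (eta * c ^+ 3) = 2 * Lt * ((d + 4) ^+ 2 * (c ^+ 2)^-1).
    by rewrite /eta; field; rewrite !lt0r_neq0.
  have : (d + 4) ^+ 2 * (c ^+ 2)^-1 <= 25 * q.
    rewrite /q mulrA ler_wpM2r ?invr_ge0 ?sqr_ge0//.
    have : (d + 4) ^+ 2 <= (5 * d) ^+ 2 by rewrite ler_sqr ?nnegrE; lra.
    lra.
  by move=> /(ler_wpM2l (ltW Lt0)); lra.
have p2 : B = L1 / 2 * q by rewrite /B /q; field; rewrite lt0r_neq0.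
have eL0 : eta * d ^+ 2 <= 1 / L0.
  rewrite /eta mul1r mulrC ler_pdivrMr// mul1r mulrC ler_pdivlMr//.
  have x1 : d ^+ 2 <= (d + 4) ^+ 2 * c.
    apply: (@le_trans _ _ ((d + 4) ^+ 2 * 1)); last by rewrite ler_wpM2l ?sqr_ge0.
    by rewrite mulr1 ler_sqr ?nnegrE ?ltW//; lra.
  have x2 := ler_pM (sqr_ge0 d) (ltW L00) x1 LL0.
  have x3 : 0 <= (d + 4) ^+ 2 * c * Lt by rewrite !mulr_ge0 ?sqr_ge0// ltW.
  lra.
have dd : 1 <= d ^+ 2 by rewrite exprn_ege1.
have eL0' : eta <= 1 / L0.
  by apply: le_trans eL0; rewrite ler_peMr// ltW.
have p3 : eta * G0 / c ^+ 3 <= G0 / L0 * q.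
  have -> : eta * G0 / c ^+ 3 = eta * (G0 * (c ^+ 3)^-1) by ring.
  have x1 : (c ^+ 3)^-1 <= q.
    rewrite /q -div1r ler_pdivrMr//.
    have -> : d ^+ 2 * (c ^+ 2)^-1 * c ^+ 3 = d ^+ 2 * c by field; exact: lt0r_neq0.
    by rewrite mulr_ege1.
  have x2 := ler_wpM2l G00 x1.
  have g0 : 0 <= G0 * (c ^+ 3)^-1 by rewrite mulr_ge0// invr_ge0 ltW.
  have := ler_pM (ltW e0) g0 eL0' x2; lra.
have p4 : eta * V <= 3 / 2 * L1 ^+ 2 * (m + 3) / L0 * q.
  have -> : eta * V = (eta * d ^+ 2) * (3 / 2 * L1 ^+ 2 * (m + 3) * q).
    by rewrite /V /q; field; exact: lt0r_neq0.
  have x1 : 0 <= 3 / 2 * L1 ^+ 2 * (m + 3) * q.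
    by rewrite mulr_ge0 ?(ltW q0)// mulr_ge0 ?addr_ge0// mulr_ge0 ?sqr_ge0.
  have := ler_wpM2r x1 eL0; lra.
have z1 : 0 <= D0 * (50 * Lt * q).
  by apply: mulr_ge0 => //; apply: mulr_ge0 (ltW q0); apply: mulr_ge0 => //; exact: ltW.
have z2 : 0 <= L1 * q by rewrite mulr_ge0// ltW.
have z3 : 0 <= G0 / L0 * q by rewrite mulr_ge0 ?(ltW q0)// divr_ge0// ltW.
have z4 : 0 <= 3 / 2 * L1 ^+ 2 * (m + 3) / L0 * q.
  by rewrite mulr_ge0 ?(ltW q0)// divr_ge0 ?(ltW L00)// mulr_ge0 ?addr_ge0// mulr_ge0 ?sqr_ge0.
rewrite -/q p2.
by move: p1 p3 p4 z1 z2 z3 z4; clear; set Y := 3 / 2 * L1 ^+ 2 * (m + 3) / L0; lra.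
Qed.

End real_sequences.

(** * From the mean of the gaps to the gap at the averaged iterate *)

Section averaging.
Context {R : realType} (d : nat) (f : 'rV[R]_d -> R).
Hypothesis f_convex : convex_fun f.

Lemma convex_mean (n : nat) (y : nat -> 'rV[R]_d) : (0 < n)%N ->
  f (n%:R^-1 *: \sum_(t < n) y t) <= n%:R^-1 * \sum_(t < n) f (y t).
Proof.
case: n => // n _; elim: n => [|n IH].
  by rewrite !big_ord_recr !big_ord0/= !add0r invr1 scale1r mul1r.
have n1 : n.+1%:R != 0 :> R by rewrite pnatr_eq0.
have n2 : n.+2%:R != 0 :> R by rewrite pnatr_eq0.
pose s : R := n.+2%:R^-1.
have sE : 1 - s = n.+1%:R / n.+2%:R.
  have -> : n.+1%:R = n.+2%:R - 1 :> R by rewrite -[n.+2%:R]natr1 addrK.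
  by rewrite mulrBl mul1r divff.
have s0 : 0 <= s by rewrite invr_ge0.
have s1 : s <= 1 by rewrite invf_le1 ?ltr0n// ler1n.
have := convex_fun_le (n.+1%:R^-1 *: \sum_(t < n.+1) y t) (y n.+1) f_convex s0 s1.
rewrite scalerA (_ : (1 - s) * n.+1%:R^-1 = s); last by rewrite sE mulrAC divff// mul1r.
rewrite -scalerDr => h; rewrite [X in f (_ *: X)]big_ord_recr/=; apply: (le_trans h).
rewrite [X in _ <= _ * X]big_ord_recr/= mulrDr lerD2r.
have := ler_wpM2l (_ : 0 <= 1 - s) IH; rewrite mulrA.
rewrite (_ : (1 - s) * n.+1%:R^-1 = s); last by rewrite sE mulrAC divff// mul1r.
by apply; rewrite subr_ge0.
Qed.

Context disp (T : measurableType disp) (P : probability T R).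

Lemma expectation_Rintegral (X : T -> R) : P.-integrable setT (EFin \o X) ->
  ('E_P[X] = (\int[P]_w X w)%R%:E)%E.
Proof.
by move=> iX; rewrite unlock /Rintegral fineK//; exact: (integrable_fin_num measurableT iX).
Qed.

(** By Jensen's inequality the value at the average lies below the mean of the values; minimality of
    [xs] bounds it from below, and the two bounds together give its integrability. *)
Lemma average_gap_le (x : nat -> T -> 'rV[R]_d) (xs : 'rV[R]_d) (n : nat) : (0 < n)%N ->
  continuous f -> global_minimizer f xs ->
  (forall t i, measurable_fun setT (fun w => x t w ord0 i)) ->
  (forall t, P.-integrable setT (EFin \o (fun w => f (x t w)))) ->
  ('E_P[fun w => f (average_iterate x n w)] - (f xs)%:E <=
   (n%:R^-1 * \sum_(t < n) (\int[P]_w f (x t w) - f xs))%:E)%E.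
Proof.
move=> n0 cf ms mx ix.
have iS := Int_sum (index_enum 'I_n) (fun t : 'I_n => ix t).
have iM := IntZ n%:R^-1 iS.
have le w : f (average_iterate x n w) <= n%:R^-1 * \sum_(t < n) f (x t w).
  exact: (convex_mean (fun t => x t w) n0).
have iA : P.-integrable setT (EFin \o (fun w => f (average_iterate x n w))).
  have iB := IntD (Int_cst P `|f xs|) (IntD iM (Int_cst P (- f xs))).
  apply: (Int_dom _ iB) => [|w].
    apply: (measurable_fun_continuous_rV _ cf) => i.
    rewrite /average_iterate; under eq_fun do rewrite !mxE summxE.
    by apply: measurable_funM => //; apply: measurable_sum => t; exact: mx.
  have h1 := ms (average_iterate x n w).
  have : `|f (average_iterate x n w)| <= `|f xs| + (f (average_iterate x n w) - f xs).
    have := ler_normD (f xs) (f (average_iterate x n w) - f xs).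
    by rewrite subrKC (ger0_norm (_ : 0 <= f (average_iterate x n w) - f xs)) ?subr_ge0.
  by have := le w; lra.
rewrite expectation_Rintegral// -EFinB lee_fin sumrB sumr_const card_ord mulrBr.
rewrite (_ : n%:R^-1 * (f xs *+ n) = f xs); last first.
  by rewrite -(mulr_natl (f xs)) mulrA mulVf ?mul1r// pnatr_eq0 -lt0n.
rewrite lerD2r; apply: (le_trans (E_le iA iM le)).
by rewrite EZ// E_sum.
Qed.

End averaging.

Lemma residual_feedback_lipschitz (R : realType) (d n : nat) (L0 : R)
    (f : 'rV[R]_d -> R) (x0 xs : 'rV[R]_d) (disp : measure_display)
    (T : measurableType disp) (P : probability T R) (u x g : nat -> T -> 'rV[R]_d)
    (eta delta : R) :
  (0 < d)%N -> (0 < n)%N -> 0 < L0 ->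
  convex_fun f -> lipschitz_const L0 f -> global_minimizer f xs ->
  iid_standard_gaussian P u ->
  eta = 1 / (2 * d%:R * L0 * Num.sqrt n%:R) ->
  delta = 1 / Num.sqrt n%:R ->
  residual_feedback_run f eta delta x0 u x g ->
  ('E_P[fun w => f (average_iterate x n w)] - (f xs)%:E <=
    ((enorm (x0 - xs) ^+ 2 * L0 + 10 * L0 + second_moment P (g 0%N) / (2 * L0))
      * (d%:R * n%:R `^ (- (1 / 2))))%:E)%E.
Proof.
move=> d0 n0 L00 cf fL ms iid etaE deltaE run.
have d1 : 1 <= d%:R :> R by rewrite ler1n.
pose s : R := Num.sqrt n%:R.
have s1 : 1 <= s by rewrite -sqrtr1 ler_sqrt ?ler1n.
have s0 : 0 < s by rewrite (lt_le_trans _ s1).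
have s2 : s ^+ 2 = n%:R by rewrite sqr_sqrtr.
have delta0 : 0 < delta by rewrite deltaE divr_gt0.
have eta0 : 0 < eta by rewrite etaE divr_gt0// !mulr_gt0// ltr0n.
have L0' := ltW L00.
have fc := lipschitz_const_continuous L0' fL.
have ix t := fx_int xs delta0 L0' fL iid run d0 t.
have mu t i : measurable_fun setT (fun w => u t w ord0 i).
  by have [/(_ t)[+ _ _] _] := iid; exact: random_vector_coord.
have mx t i : measurable_fun setT (fun w => x t w ord0 i).
  by have [+ _] := run_measurable fc run (fun s i _ => mu s i) (leqnn t); apply.
apply: (le_trans (average_gap_le cf n0 fc ms mx ix)); rewrite lee_fin.
pose D t := \int[P]_w enorm (x t w - xs) ^+ 2.
pose G t := \int[P]_w enorm (g t w) ^+ 2.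
have D0E : D 0%N = enorm (x0 - xs) ^+ 2.
  by rewrite -[RHS](E_cst P); apply: eq_Rintegral => w _; rewrite (rf_x0 run).
have G0E : second_moment P (g 0%N) = G 0%N by rewrite /second_moment unlock.
have Dge t : 0 <= D t by apply: E_ge0 => w; exact: sqr_ge0.
have Gge t : 0 <= G t by apply: E_ge0 => w; exact: sqr_ge0.
have Grec t : G t.+1 <= G t / 2 + 16 * L0 ^+ 2 * d%:R ^+ 2.
  have [_ h] := g_norm2_rec delta0 L0' fL iid run d0
    (g_norm2_int delta0 L0' fL iid run d0 t).
  apply: (le_trans h); rewrite lerD2r mulrC; apply: (ler_wpM2l (Gge t)).
  (* The ratio eta / delta is 1 / (2 d L0): the horizon cancels, so the contraction is uniform in
     it. *)
  have -> : 2 * L0 ^+ 2 * eta ^+ 2 * d%:R / delta ^+ 2 = 1 / 2 * (1 / d%:R) :> R.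
    by rewrite etaE deltaE -/s; field; rewrite !lt0r_neq0// ltr0n.
  have : 1 / d%:R <= 1 :> R by rewrite ler_pdivrMr ?mul1r// ltr0n.
  lra.
pose F t := \int[P]_w f (x t w) - f xs.
have Drec t : D t.+1 <= D t - 2 * eta * (F t - 2 * (L0 * delta * d%:R)) + eta ^+ 2 * G t.
  have gap := lipschitz_gap_le xs delta0 L0' fL iid run d0 cf t.
  rewrite /D (distance_rec xs delta0 L0' fL iid run d0 t) lerD2r lerD2l lerN2.
  by apply: ler_wpM2l; [rewrite mulr_ge0// ltW|rewrite /F; lra].
have h1 := descent_sum n Drec Dge.
have h2 := sum_contraction n Grec Gge.
rewrite powRN mul1r powR12_sqrt// -/s -{1}s2 G0E -D0E.
apply: lipschitz_rate => //.
rewrite -/s in etaE deltaE.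
rewrite etaE deltaE -{1}s2 in h1; rewrite -s2 in h2.
apply: (le_trans h1); rewrite lerD2l ler_wpM2l ?sqr_ge0//.
Qed.

Lemma residual_feedback_smooth (R : realType) (d n : nat) (L0 L1 : R)
    (f : 'rV[R]_d -> R) (x0 xs : 'rV[R]_d) (disp : measure_display)
    (T : measurableType disp) (P : probability T R) (u x g : nat -> T -> 'rV[R]_d)
    (eta delta : R) :
  (0 < d)%N -> (0 < n)%N -> 0 < L0 -> 0 < L1 ->
  convex_fun f -> lipschitz_const L0 f -> lipschitz_gradient_const L1 f ->
  global_minimizer f xs ->
  iid_standard_gaussian P u ->
  eta = 1 / (2 * Num.max L0 (16 * L1) * (d%:R + 4) ^+ 2 * n%:R `^ (1 / 3)) ->
  delta = Num.sqrt d%:R / n%:R `^ (1 / 3) ->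
  residual_feedback_run f eta delta x0 u x g ->
  ('E_P[fun w => f (average_iterate x n w)] - (f xs)%:E <=
    ((110 * Num.max L0 (16 * L1) * enorm (x0 - xs) ^+ 2 + 11 / 5 * L1
       + 11 / 5 * (second_moment P (g 0%N) / L0 + 3 / 2 * L1 ^+ 2 * (normal_m6 + 3) / L0))
      * (d%:R ^+ 2 * n%:R `^ (- (2 / 3))))%:E)%E.
Proof.
move=> d0 n0 L00 L10 cf fL fG ms iid etaE deltaE run.
have d1 : 1 <= d%:R :> R by rewrite ler1n.
have dp : 0 < d%:R :> R by rewrite ltr0n.
have np : 0 < n%:R :> R by rewrite ltr0n.
set Lt := Num.max L0 (16 * L1) in etaE *.
have LL0 : L0 <= Lt by rewrite le_max lexx.
have LL1 : 16 * L1 <= Lt by rewrite le_max lexx orbT.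
pose c : R := n%:R `^ (1 / 3).
have c0 : 0 < c by exact: powR_gt0.
have c3 : c ^+ 3 = n%:R.
  by rewrite -powR_mulrn ?ltW// /c -powRrM mul1r mulVf ?powRr1// ltW.
have c1 : 1 <= c.
  have : (1 : R) ^+ 3 <= c ^+ 3 by rewrite c3 expr1n ler1n.
  by rewrite ler_pXn2r ?nnegrE// ltW.
have c2 : n%:R `^ (- (2 / 3)) = (c ^+ 2)^-1.
  rewrite powRN; congr (_^-1); rewrite -powR_mulrn ?ltW// /c -powRrM.
  by congr (_ `^ _); field.
have delta2 : delta ^+ 2 = d%:R / c ^+ 2.
  by rewrite deltaE expr_div_n sqr_sqrtr.
have delta0 : 0 < delta by rewrite deltaE divr_gt0// sqrtr_gt0.
have Lt0 : 0 < Lt by rewrite (lt_le_trans L00).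
have eta0 : 0 < eta.
  by rewrite etaE divr_gt0// !mulr_gt0// ?exprn_gt0// addr_gt0.
have L0' := ltW L00.
have fc := lipschitz_const_continuous L0' fL.
have ix t := fx_int xs delta0 L0' fL iid run d0 t.
have mu t i : measurable_fun setT (fun w => u t w ord0 i).
  by have [/(_ t)[+ _ _] _] := iid; exact: random_vector_coord.
have mx t i : measurable_fun setT (fun w => x t w ord0 i).
  by have [+ _] := run_measurable fc run (fun s i _ => mu s i) (leqnn t); apply.
apply: (le_trans (average_gap_le cf n0 fc ms mx ix)); rewrite lee_fin.
pose D t := \int[P]_w enorm (x t w - xs) ^+ 2.
pose G t := \int[P]_w enorm (g t w) ^+ 2.
pose F t := \int[P]_w f (x t w) - f xs.
have D0E : D 0%N = enorm (x0 - xs) ^+ 2.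
  by rewrite -[RHS](E_cst P); apply: eq_Rintegral => w _; rewrite (rf_x0 run).
have G0E : second_moment P (g 0%N) = G 0%N by rewrite /second_moment unlock.
have Dge t : 0 <= D t by apply: E_ge0 => w; exact: sqr_ge0.
have Gge t : 0 <= G t by apply: E_ge0 => w; exact: sqr_ge0.
have Fge t : 0 <= F t.
  rewrite subr_ge0 -[leLHS](E_cst P); apply: E_le => //; first exact: Int_cst.
have Grec t := smooth_g_norm2_rec delta0 L0' fL iid run d0 cf L10 fG ms t.
have Drec t : D t.+1 <= D t - 2 * eta * (F t - L1 / 2 * delta ^+ 2 * d%:R) + eta ^+ 2 * G t.
  have gap := smooth_gap_le delta0 L0' fL iid run d0 cf L10 fG ms t.
  rewrite /D (distance_rec xs delta0 L0' fL iid run d0 t) lerD2r lerD2l lerN2.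
  by apply: ler_wpM2l; [rewrite mulr_ge0// ltW|rewrite /F; lra].
have m0 : 0 <= normal_m6 :> R := normal_m6_ge0.
have h1 := descent_sum n Drec Dge.
have V0 : 0 <= 3 / 2 * L1 ^+ 2 * delta ^+ 2 * (normal_m6 + 3) * d%:R ^+ 3.
  by rewrite mulr_ge0 ?exprn_ge0// mulr_ge0 ?addr_ge0// mulr_ge0 ?sqr_ge0// mulr_ge0 ?sqr_ge0.
have al0 : 0 <= 3 * L0 ^+ 2 * eta ^+ 2 * d%:R / delta ^+ 2.
  by rewrite divr_ge0 ?sqr_ge0// mulr_ge0// mulr_ge0 ?sqr_ge0// mulr_ge0 ?sqr_ge0.
have a0 : 0 <= 36 * L1 * d%:R ^+ 2 by rewrite mulr_ge0 ?sqr_ge0// mulr_ge0// ltW.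
have b0 : 0 <= 12 * L1 * d%:R ^+ 2 by rewrite mulr_ge0 ?sqr_ge0// mulr_ge0// ltW.
have h2 := sum_coupled n al0 a0 b0 V0 Grec Fge Gge.
rewrite c2 G0E -D0E -{1}c3; rewrite -/c in etaE; rewrite -c3 delta2 in h1 h2.
apply: (smooth_rate (SG := \sum_(t < n) G t)) => //.
- by apply: sumr_ge0 => t _; exact: Fge.
- by apply: sumr_ge0 => t _; exact: Gge.
- by rewrite -etaE.
- by rewrite -etaE.
Qed.

Theorem theorem9 (R : realType) :
  (exists C : R -> R -> R -> R,
    forall (d T : nat) (L0 : R) (f : 'rV[R]_d -> R) (x0 xstar : 'rV[R]_d)
      (disp : measure_display) (Omega : measurableType disp)
      (P : probability Omega R) (u x g : nat -> Omega -> 'rV[R]_d)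
      (eta delta : R),
    (0 < d)%N -> (0 < T)%N -> 0 < L0 ->
    convex_fun f -> lipschitz_const L0 f -> global_minimizer f xstar ->
    iid_standard_gaussian P u ->
    eta = 1 / (2 * d%:R * L0 * Num.sqrt T%:R) ->
    delta = 1 / Num.sqrt T%:R ->
    residual_feedback_run f eta delta x0 u x g ->
    ('E_P[fun w => f (average_iterate x T w)] - (f xstar)%:E <=
      (C L0 (enorm (x0 - xstar)) (second_moment P (g 0%N))
        * (d%:R * T%:R `^ (- (1 / 2))))%:E)%E) /\
  (exists C : R -> R -> R -> R -> R,
    forall (d T : nat) (L0 L1 : R) (f : 'rV[R]_d -> R) (x0 xstar : 'rV[R]_d)
      (disp : measure_display) (Omega : measurableType disp)
      (P : probability Omega R) (u x g : nat -> Omega -> 'rV[R]_d)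
      (eta delta : R),
    (0 < d)%N -> (0 < T)%N -> 0 < L0 -> 0 < L1 ->
    convex_fun f -> lipschitz_const L0 f -> lipschitz_gradient_const L1 f ->
    global_minimizer f xstar ->
    iid_standard_gaussian P u ->
    eta = 1 / (2 * Num.max L0 (16 * L1) * (d%:R + 4) ^+ 2
               * T%:R `^ (1 / 3)) ->
    delta = Num.sqrt d%:R / T%:R `^ (1 / 3) ->
    residual_feedback_run f eta delta x0 u x g ->
    ('E_P[fun w => f (average_iterate x T w)] - (f xstar)%:E <=
      (C L0 L1 (enorm (x0 - xstar)) (second_moment P (g 0%N))
        * (d%:R ^+ 2 * T%:R `^ (- (2 / 3))))%:E)%E).
Proof.
split.
- exists (fun L0 r m => r ^+ 2 * L0 + 10 * L0 + m / (2 * L0)).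
  move=> d T L0 f x0 xs disp Omega P u x g eta delta d0 T0 L00 cf fL ms iid eE dE run.
  exact: (residual_feedback_lipschitz d0 T0 L00 cf fL ms iid eE dE run).
- exists (fun L0 L1 r m => 110 * Num.max L0 (16 * L1) * r ^+ 2 + 11 / 5 * L1
     + 11 / 5 * (m / L0 + 3 / 2 * L1 ^+ 2 * (normal_m6 + 3) / L0)).
  move=> d T L0 L1 f x0 xs disp Omega P u x g eta delta d0 T0 L00 L10 cf fL fG ms iid eE dE run.
  exact: (residual_feedback_smooth d0 T0 L00 L10 cf fL fG ms iid eE dE run).
Qed.
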